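(* Let $S$ be a self-adjoint subspace in $X^2$, and let $A$ and $S+A$ be closed Hermitian subspaces in $X^2$, with $D(S)\subset D(A)$. Let $Q:A(0)^\perp\to S(0)^\perp$ be the orthogonal projection. If $QA_s$ is $S_s$-compact, then $\sigma_e(S)=\sigma_e(S+A)$; consequently $\sigma_e(S)=\emptyset$ if and only if $\sigma_e(S+A)=\emptyset$.
   Context: $X$ is a complex Hilbert space and $X^2=X\times X$ carries the inner product $\langle (x,f),(y,g)\rangle=\langle x,y\rangle+\langle f,g\rangle$. A subspace $T$ in $X^2$ means a linear subspace of $X^2$ (a linear relation); a linear operator in $X$ is identified with its graph. Notation: $D(T)=\{x:(x,f)\in T \text{ for some } f\}$, $T(x)=\{f:(x,f)\in T\}$, $T^{-1}=\{(f,x):(x,f)\in T\}$, $\lambda I$ is the graph of $x\mapsto\lambda x$. The adjoint is $T^*=\{(y,g)\in X^2:\langle g,x\rangle=\langle y,f\rangle \text{ for all }(x,f)\in T\}$; $T$ is Hermitian if $T\subset T^*$ and self-adjoint if $T=T^*$. For subspaces $S,A$ in $X^2$, $S+A=\{(x,f+g):(x,f)\in S,(x,g)\in A\}$. For a closed subspace $T$, set $T_\infty=\{(0,g)\in X^2:(0,g)\in T\}$ and $T_s=T\ominus T_\infty$ (orthogonal complement of $T_\infty$ in $T$), so $T=T_s\oplus T_\infty$; $T_s$ is the graph of a linear operator (the operator part of $T$) with $D(T_s)=D(T)$ and $R(T_s)\subset T(0)^\perp$. For linear operators $U,V$ in $X$ with $D(V)\subset D(U)$: $U$ is $V$-compact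 if $U|_{D(V)}$ is compact as a map from $(D(V),\|\cdot\|_V)$ into $X$, where $\|x\|_V=\|x\|+\|Vx\|$. Resolvent set: $\rho(T)=\{\lambda\in\mathbb C:(\lambda I-T)^{-1}$ is a bounded linear operator defined on all of $X\}$; spectrum $\sigma(T)=\mathbb C\setminus\rho(T)$. A number $\lambda$ is an eigenvalue of $T$ if $(x,\lambda x)\in T$ for some $x\ne 0$, with multiplicity the dimension of $\{x:(x,\lambda x)\in T\}$. The essential spectrum $\sigma_e(T)$ is the set of points of $\sigma(T)$ that are either accumulation points of $\sigma(T)$ or isolated eigenvalues of infinite multiplicity. *)

(* Defs.v *)
From Stdlib Require Import Reals.
Open Scope R_scope.

Definition C : Type := (R * R)%type.
Definition C0 : C := (0, 0).
Definition C1 : C := (1, 0).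
Definition Cadd (z w : C) : C := (fst z + fst w, snd z + snd w).
Definition Copp (z : C) : C := (- fst z, - snd z).
Definition Csub (z w : C) : C := Cadd z (Copp w).
Definition Cmul (z w : C) : C :=
  (fst z * fst w - snd z * snd w, fst z * snd w + snd z * fst w).
Definition Cconj (z : C) : C := (fst z, - snd z).
Definition Cmod (z : C) : R := sqrt (fst z * fst z + snd z * snd z).

Record CHilbert := {
  hcar :> Type;
  hzero : hcar;
  hadd : hcar -> hcar -> hcar;
  hopp : hcar -> hcar;
  hscal : C -> hcar -> hcar;
  hinner : hcar -> hcar -> C;
  hadd_assoc : forall x y z, hadd x (hadd y z) = hadd (hadd x y) z;
  hadd_comm : forall x y, hadd x y = hadd y x;
  hadd_zero : forall x, hadd hzero x = x;
  hadd_opp : forall x, hadd x (hopp x) = hzero;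
  hscal_assoc : forall a b x, hscal a (hscal b x) = hscal (Cmul a b) x;
  hscal_one : forall x, hscal C1 x = x;
  hscal_distr_v : forall a x y, hscal a (hadd x y) = hadd (hscal a x) (hscal a y);
  hscal_distr_s : forall a b x, hscal (Cadd a b) x = hadd (hscal a x) (hscal b x);
  hinner_add : forall x y z, hinner (hadd x y) z = Cadd (hinner x z) (hinner y z);
  hinner_scal : forall a x y, hinner (hscal a x) y = Cmul a (hinner x y);
  hinner_conj : forall x y, hinner y x = Cconj (hinner x y);
  hinner_pos : forall x, 0 <= fst (hinner x x);
  hinner_def : forall x, hinner x x = C0 -> x = hzero;
  hcomplete : forall u : nat -> hcar,
    (forall eps, eps > 0 -> exists N, forall n m, (n >= N)%nat -> (m >= N)%nat ->
        sqrt (fst (hinner (hadd (u n) (hopp (u m))) (hadd (u n) (hopp (u m))))) < eps) ->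
    exists l, forall eps, eps > 0 -> exists N, forall n, (n >= N)%nat ->
        sqrt (fst (hinner (hadd (u n) (hopp l)) (hadd (u n) (hopp l)))) < eps
}.

Arguments hzero {_}.
Arguments hadd {_} _ _.
Arguments hopp {_} _.
Arguments hscal {_} _ _.
Arguments hinner {_} _ _.

Section Defs.
Context {X : CHilbert}.

Definition hsub (x y : X) : X := hadd x (hopp y).
Definition hnorm (x : X) : R := sqrt (fst (hinner x x)).

Definition hconv (u : nat -> X) (l : X) : Prop :=
  forall eps, eps > 0 -> exists N, forall n, (n >= N)%nat -> hnorm (hsub (u n) l) < eps.

Definition rel : Type := X -> X -> Prop.

Definition inner2 (x f y g : X) : C := Cadd (hinner x y) (hinner f g).
Definition norm2 (x f : X) : R := sqrt (fst (inner2 x f x f)).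

Definition is_subspace (T : rel) : Prop :=
  T hzero hzero /\
  (forall x f y g, T x f -> T y g -> T (hadd x y) (hadd f g)) /\
  (forall a x f, T x f -> T (hscal a x) (hscal a f)).

Definition is_closed (T : rel) : Prop :=
  forall (x f : nat -> X) (x0 f0 : X),
    (forall n, T (x n) (f n)) ->
    (forall eps, eps > 0 -> exists N, forall n, (n >= N)%nat ->
        norm2 (hsub (x n) x0) (hsub (f n) f0) < eps) ->
    T x0 f0.

Definition dom (T : rel) (x : X) : Prop := exists f, T x f.
Definition img_at (T : rel) (x f : X) : Prop := T x f.

Definition adjoint (T : rel) : rel :=
  fun y g => forall x f, T x f -> hinner g x = hinner y f.

Definition is_hermitian (T : rel) : Prop := forall x f, T x f -> adjoint T x f.
Definition is_selfadjoint (T : rel) : Prop := forall x f, T x f <-> adjoint T x f.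

Definition rel_sum (S A : rel) : rel :=
  fun x h => exists f g, S x f /\ A x g /\ h = hadd f g.

Definition T_inf (T : rel) : rel := fun x g => x = hzero /\ T x g.

Definition T_s (T : rel) : rel :=
  fun x f => T x f /\ (forall y g, T_inf T y g -> inner2 x f y g = C0).

Definition perp0 (T : rel) (z : X) : Prop := forall g, T hzero g -> hinner z g = C0.

Definition is_orth_proj (W : X -> Prop) (x y : X) : Prop :=
  W y /\ (forall z, W z -> hinner (hsub x y) z = C0).

(* Q T_s, where Q is the orthogonal projection onto S(0)^perp
   (restricted to A(0)^perp, which contains the range of A_s). *)
Definition proj_comp (S A : rel) : rel :=
  fun x u => exists f, T_s A x f /\ is_orth_proj (perp0 S) f u.

(* U is V-compact: D(V) ⊂ D(U), and U restricted to (D(V), ||.||_V) is a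
   compact map into X: every ||.||_V-bounded sequence in D(V) is mapped
   to a sequence having a convergent subsequence. *)
Definition rel_compact_wrt (U V : rel) : Prop :=
  (forall x, dom V x -> dom U x) /\
  forall (x y u : nat -> X) (M : R),
    (forall n, V (x n) (y n)) ->
    (forall n, U (x n) (u n)) ->
    (forall n, hnorm (x n) + hnorm (y n) <= M) ->
    exists (phi : nat -> nat) (l : X),
      (forall n, (phi n < phi (S n))%nat) /\ hconv (fun n => u (phi n)) l.

(* lambda in rho(T): (lambda I - T)^{-1} = {(lambda x - f, x) : (x,f) in T}
   is a bounded linear operator defined on all of X. *)
Definition resolvent (T : rel) (lam : C) : Prop :=
  (forall y, exists x f, T x f /\ y = hsub (hscal lam x) f) /\
  (forall x1 f1 x2 f2, T x1 f1 -> T x2 f2 ->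
       hsub (hscal lam x1) f1 = hsub (hscal lam x2) f2 -> x1 = x2) /\
  (exists c : R, forall x f, T x f -> hnorm x <= c * hnorm (hsub (hscal lam x) f)).

Definition spectrum (T : rel) (lam : C) : Prop := ~ resolvent T lam.

Definition eigvec (T : rel) (lam : C) (x : X) : Prop := T x (hscal lam x).

Definition is_eigenvalue (T : rel) (lam : C) : Prop :=
  exists x, x <> hzero /\ eigvec T lam x.

Fixpoint lin_comb (c : nat -> C) (v : nat -> X) (n : nat) : X :=
  match n with
  | O => hzero
  | S k => hadd (lin_comb c v k) (hscal (c k) (v k))
  end.

Definition infinite_multiplicity (T : rel) (lam : C) : Prop :=
  forall n : nat, exists v : nat -> X,
    (forall i, (i < n)%nat -> eigvec T lam (v i)) /\
    (forall c : nat -> C, lin_comb c v n = hzero -> forall i, (i < n)%nat -> c i = C0).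

Definition accumulation_point (P : C -> Prop) (lam : C) : Prop :=
  forall eps, eps > 0 -> exists mu, P mu /\ mu <> lam /\ Cmod (Csub mu lam) < eps.

Definition ess_spectrum (T : rel) (lam : C) : Prop :=
  spectrum T lam /\
  (accumulation_point (spectrum T) lam \/
   (~ accumulation_point (spectrum T) lam /\ is_eigenvalue T lam /\
    infinite_multiplicity T lam)).

End Defs.

(* Main.v *)
(** For self-adjoint [T] and real [lam], [lam] lies outside the essential spectrum if and
    only if [T - lam] is "proper": every bounded sequence whose images under [T - lam] can
    be chosen Cauchy has a Cauchy subsequence. A proper [T - lam] has finite-dimensional
    kernel and a lower bound on the orthogonal complement of its kernel, which puts a
    punctured neighbourhood of [lam] in the resolvent set. Conversely, a gap
    [(lam - eps, lam + eps)] punctured at [lam] gives [eps |x| <= |(T - lam) x|] for [x]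
    orthogonal to the kernel.

    On [S(0)^perp] the operator part of [S + A] is [S_s + Q A_s]. Compactness makes [Q A_s]
    bounded relative to [S_s] with bound [1/2], so [S + A] is self-adjoint, and properness
    of [S - lam] and of [S + A - lam] are equivalent: along a suitable subsequence
    [Q A_s x_n] converges. *)

From Stdlib Require Import Reals Lra Lia List Classical ClassicalEpsilon.
Require Import Defs.

Declare Scope hilbert_scope.
Local Open Scope hilbert_scope.
Local Open Scope R_scope.

Local Notation "x [+] y" := (hadd x y) (at level 50, left associativity) : hilbert_scope.
Local Notation "x [-] y" := (hsub x y) (at level 50, left associativity) : hilbert_scope.
Local Notation "a [*] x" := (hscal a x) (at level 40, no associativity) : hilbert_scope.

(** The main obstacle is to turn a spectral gap into a norm bound without a spectral theorem. On an
    interval of radius [r] around 0 free of spectrum, a constant [s < r^2] with [s |x|^2 <= |T x|^2]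
    can always be enlarged, so the supremum of such constants is [r^2]. A punctured gap contains two
    such intervals, centred at plus and minus [eps / 2], whose inequalities are then combined. The
    second obstacle is multivaluedness: images are determined only up to the multivalued part.
    Symmetry puts [A(0)] in the orthogonal complement of [D(A)], hence of [D(S)], and that
    complement is [S(0)]. So [S] and [S + A] have the same multivalued part, and replacing images by
    their components orthogonal to [S(0)] does not increase distances. Any relative bound below 1
    would do for self-adjointness; with 1/2, the remaining term [c |x|] is made small by moving far
    up the imaginary axis. *)

Lemma Cpair_eq (z w : C) : fst z = fst w -> snd z = snd w -> z = w.
Proof. destruct z, w; simpl; congruence. Qed.

Lemma choice_fun {U V : Type} (P : U -> V -> Prop) :
  (forall u, exists v, P u v) -> exists g : U -> V, forall u, P u (g u).
Proof.
  intro H.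
  exists (fun u => proj1_sig (constructive_indefinite_description _ (H u))).
  intro u. exact (proj2_sig (constructive_indefinite_description _ (H u))).
Qed.

Lemma inv_INR_S_small (eps : R) : eps > 0 -> exists N, forall n, (n >= N)%nat -> / INR (S n) < eps.
Proof.
  intro He. destruct (archimed_cor1 eps He) as [N [HN HN0]].
  exists N. intros n Hn. apply Rle_lt_trans with (2 := HN).
  apply Rinv_le_contravar.
  - apply lt_0_INR; lia.
  - apply le_INR; lia.
Qed.

Lemma INR_S_inv_pos (n : nat) : 0 < / INR (S n).
Proof. apply Rinv_0_lt_compat, lt_0_INR; lia. Qed.

Lemma sq_le_reg (a b : R) : 0 <= b -> a * a <= b * b -> a <= b.
Proof. intros; destruct (Rle_dec a b); auto; nra. Qed.

Lemma sq_lt_reg (a b : R) : 0 <= b -> a * a < b * b -> a < b.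
Proof. intros; destruct (Rlt_dec a b); auto; nra. Qed.

(** * Subsequences *)

Definition increasing (phi : nat -> nat) : Prop := forall n, (phi n < phi (S n))%nat.

Lemma increasing_ge (phi : nat -> nat) : increasing phi -> forall n, (n <= phi n)%nat.
Proof. intros H n; induction n; [lia|]. specialize (H n). lia. Qed.

Lemma increasing_lt (phi : nat -> nat) :
  increasing phi -> forall n m, (n < m)%nat -> (phi n < phi m)%nat.
Proof.
  intros H n m Hnm; induction Hnm; [apply H|]. specialize (H m). lia.
Qed.

Lemma increasing_comp (phi psi : nat -> nat) :
  increasing phi -> increasing psi -> increasing (fun n => phi (psi n)).
Proof. intros Hp Hq n. apply increasing_lt; auto. Qed.

Lemma bounded_subseq_cv (u : nat -> R) (M : R) :
  (forall n, Rabs (u n) <= M) ->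
  exists phi l, increasing phi /\ Un_cv (fun n => u (phi n)) l.
Proof.
  intro HM.
  destruct (Bolzano_Weierstrass u (fun c => - M <= c <= M) (compact_P3 _ _)) as [l Hl].
  { intro n. specialize (HM n). generalize (Rle_abs (u n)) (Rle_abs (- u n)).
    rewrite Rabs_Ropp. lra. }
  (* The pair holds the required accuracy and the last index taken; the cluster value [l] supplies a
     later index, and iterating the choice gives the subsequence. *)
  assert (Hstep : forall p : nat * nat, exists q, (snd p < q)%nat /\
            Rabs (u q - l) < / INR (S (fst p))).
  { intros [k p]. simpl.
    destruct (Hl (fun y => Rabs (y - l) < / INR (S k)) (S p)) as [q [Hq1 Hq2]].
    - exists (mkposreal _ (INR_S_inv_pos k)). intros y Hy. exact Hy.
    - exists q. split; [lia|exact Hq2]. }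
  apply choice_fun in Hstep. destruct Hstep as [g Hg].
  set (phi := fix phi n := match n with O => g (O, O) | S k => g (S k, phi k) end).
  exists phi, l. split.
  - intro n. apply (Hg (S n, phi n)).
  - assert (Hphi : forall n, Rabs (u (phi n) - l) < / INR (S n)).
    { intros [|n]; [apply (Hg (O, O))|apply (Hg (S n, phi n))]. }
    intros eps He. destruct (inv_INR_S_small eps He) as [N HN].
    exists N. intros n Hn. unfold Rdist.
    apply Rlt_trans with (1 := Hphi n). apply HN, Hn.
Qed.

(** * Inner product and norm *)

Section InnerProduct.
Context {X : CHilbert}.
Implicit Types x y z f g h p : X.

Definition re x y : R := fst (hinner x y).
Definition im x y : R := snd (hinner x y).

Lemma re_sym x y : re y x = re x y.
Proof. unfold re. rewrite hinner_conj. reflexivity. Qed.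

Lemma im_sym x y : im y x = - im x y.
Proof. unfold im. rewrite hinner_conj. reflexivity. Qed.

Lemma re_add_l x y z : re (x [+] y) z = re x z + re y z.
Proof. unfold re. rewrite hinner_add. reflexivity. Qed.

Lemma im_add_l x y z : im (x [+] y) z = im x z + im y z.
Proof. unfold im. rewrite hinner_add. reflexivity. Qed.

Lemma re_scal_l a x y : re (a [*] x) y = fst a * re x y - snd a * im x y.
Proof. unfold re, im. rewrite hinner_scal. reflexivity. Qed.

Lemma im_scal_l a x y : im (a [*] x) y = fst a * im x y + snd a * re x y.
Proof. unfold re, im. rewrite hinner_scal. reflexivity. Qed.

Lemma re_zero_l y : re hzero y = 0.
Proof. generalize (re_add_l hzero hzero y). rewrite hadd_zero. lra. Qed.

Lemma im_zero_l y : im hzero y = 0.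
Proof. generalize (im_add_l hzero hzero y). rewrite hadd_zero. lra. Qed.

Lemma re_opp_l x y : re (hopp x) y = - re x y.
Proof. generalize (re_add_l x (hopp x) y). rewrite hadd_opp, re_zero_l. lra. Qed.

Lemma im_opp_l x y : im (hopp x) y = - im x y.
Proof. generalize (im_add_l x (hopp x) y). rewrite hadd_opp, im_zero_l. lra. Qed.

Lemma re_sub_l x y z : re (x [-] y) z = re x z - re y z.
Proof. unfold hsub. rewrite re_add_l, re_opp_l. lra. Qed.

Lemma im_sub_l x y z : im (x [-] y) z = im x z - im y z.
Proof. unfold hsub. rewrite im_add_l, im_opp_l. lra. Qed.

Lemma re_add_r x y z : re z (x [+] y) = re z x + re z y.
Proof. rewrite !(re_sym _ z). apply re_add_l. Qed.

Lemma im_add_r x y z : im z (x [+] y) = im z x + im z y.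
Proof. rewrite !(im_sym _ z), im_add_l. lra. Qed.

Lemma re_sub_r x y z : re z (x [-] y) = re z x - re z y.
Proof. rewrite !(re_sym _ z). apply re_sub_l. Qed.

Lemma im_sub_r x y z : im z (x [-] y) = im z x - im z y.
Proof. rewrite !(im_sym _ z), im_sub_l. lra. Qed.

Lemma re_opp_r x y : re y (hopp x) = - re y x.
Proof. rewrite !(re_sym _ y). apply re_opp_l. Qed.

Lemma im_opp_r x y : im y (hopp x) = - im y x.
Proof. rewrite !(im_sym _ y), im_opp_l. lra. Qed.

Lemma re_scal_r a x y : re y (a [*] x) = fst a * re y x + snd a * im y x.
Proof. rewrite !(re_sym _ y), re_scal_l, (im_sym y x). lra. Qed.

Lemma im_scal_r a x y : im y (a [*] x) = fst a * im y x - snd a * re y x.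
Proof. rewrite !(im_sym _ y), im_scal_l, (re_sym y x). lra. Qed.

Lemma re_zero_r y : re y hzero = 0.
Proof. rewrite re_sym. apply re_zero_l. Qed.

Lemma im_zero_r y : im y hzero = 0.
Proof. rewrite im_sym, im_zero_l. lra. Qed.

Lemma im_diag x : im x x = 0.
Proof. generalize (im_sym x x). lra. Qed.

Lemma re_diag_ge0 x : 0 <= re x x.
Proof. apply hinner_pos. Qed.

Lemma hinner_eq0 x y : hinner x y = C0 <-> re x y = 0 /\ im x y = 0.
Proof.
  split.
  - intro H. unfold re, im. rewrite H. split; reflexivity.
  - intros [H1 H2]. apply Cpair_eq; assumption.
Qed.

Lemma hinner_eqP x y x' y' :
  hinner x y = hinner x' y' <-> re x y = re x' y' /\ im x y = im x' y'.
Proof.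
  split.
  - intro H. unfold re, im. rewrite H. split; reflexivity.
  - intros [H1 H2]. apply Cpair_eq; assumption.
Qed.

Lemma re_diag_eq0 x : re x x = 0 -> x = hzero.
Proof. intro H. apply hinner_def, hinner_eq0. split; [exact H|apply im_diag]. Qed.

Lemma hsub_eq0 x y : x [-] y = hzero -> x = y.
Proof.
  unfold hsub. intro H.
  assert (E : (x [+] hopp y) [+] y = y) by (rewrite H; apply hadd_zero).
  rewrite <- hadd_assoc, (hadd_comm _ (hopp y)), hadd_opp, hadd_comm, hadd_zero in E.
  exact E.
Qed.

Lemma re_ext x y : (forall z, re x z = re y z) -> x = y.
Proof.
  intro H. apply hsub_eq0, re_diag_eq0. rewrite re_sub_l, H. lra.
Qed.

End InnerProduct.

Ltac ip_expand :=
  repeat (rewrite ?re_sub_l, ?im_sub_l, ?re_sub_r, ?im_sub_r, ?re_add_l, ?im_add_l,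
    ?re_add_r, ?im_add_r, ?re_opp_l, ?im_opp_l, ?re_opp_r, ?im_opp_r,
    ?re_scal_l, ?im_scal_l, ?re_scal_r, ?im_scal_r, ?re_zero_l, ?im_zero_l,
    ?re_zero_r, ?im_zero_r, ?im_diag); cbn [fst snd Cadd Copp Csub Cmul Cconj C0 C1].

(* An identity between vectors is an identity between their pairings with an arbitrary
   vector, which [ring] can check. *)
Ltac vec := apply re_ext; intro; ip_expand; ring.

Section Topology.
Context {X : CHilbert}.
Implicit Types x y z f g h p : X.

Lemma hnorm_ge0 x : 0 <= hnorm x.
Proof. apply sqrt_pos. Qed.

Lemma hnorm_sq x : hnorm x * hnorm x = re x x.
Proof. apply sqrt_sqrt, re_diag_ge0. Qed.

Lemma hnorm_zero : hnorm (hzero : X) = 0.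
Proof. unfold hnorm. fold (re (hzero : X) hzero). rewrite re_zero_l. apply sqrt_0. Qed.

Lemma hnorm_eq0 x : hnorm x = 0 -> x = hzero.
Proof. intro H. apply re_diag_eq0. rewrite <- hnorm_sq, H. lra. Qed.

Lemma hnorm_re_eq x y : re x x = re y y -> hnorm x = hnorm y.
Proof. unfold re, hnorm. congruence. Qed.

Lemma hnorm_opp x : hnorm (hopp x) = hnorm x.
Proof. apply hnorm_re_eq. ip_expand. ring. Qed.

Lemma hnorm_sub_sym x y : hnorm (x [-] y) = hnorm (y [-] x).
Proof. apply hnorm_re_eq. ip_expand. ring. Qed.

Lemma hnorm_rscal (a : R) x : hnorm ((a, 0) [*] x) = Rabs a * hnorm x.
Proof.
  apply Rsqr_inj; unfold Rsqr.
  - apply hnorm_ge0.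
  - apply Rmult_le_pos; [apply Rabs_pos|apply hnorm_ge0].
  - rewrite hnorm_sq. ip_expand. rewrite <- hnorm_sq.
    replace (Rabs a * hnorm x * (Rabs a * hnorm x))
      with (Rabs a * Rabs a * (hnorm x * hnorm x)) by ring.
    rewrite <- Rabs_mult, (Rabs_pos_eq (a * a)) by nra. ring.
Qed.

Lemma cauchy_schwarz x y : re x y <= hnorm x * hnorm y.
Proof.
  generalize (hnorm_ge0 x) (hnorm_ge0 y) (hnorm_sq x) (hnorm_sq y); intros Hx Hy Hxx Hyy.
  destruct (Req_dec (hnorm x) 0) as [E|E].
  { rewrite E. apply hnorm_eq0 in E. subst x. rewrite re_zero_l. lra. }
  (* The square of [|y| x - |x| y] is [2 |x| |y| (|x| |y| - re x y)]; it remains to cancel the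
     positive factor. *)
  generalize (re_diag_ge0 ((hnorm y, 0) [*] x [-] (hnorm x, 0) [*] y)).
  ip_expand. rewrite (re_sym x y), <- Hxx, <- Hyy. intro H.
  destruct (Req_dec (hnorm y) 0) as [F|F].
  { rewrite F. apply hnorm_eq0 in F. subst y. rewrite re_zero_r. lra. }
  assert (0 < hnorm x * hnorm y) by (apply Rmult_lt_0_compat; lra).
  apply Rmult_le_reg_l with (hnorm x * hnorm y); [assumption|]. nra.
Qed.

Lemma cauchy_schwarz_abs x y : Rabs (re x y) <= hnorm x * hnorm y.
Proof.
  apply Rabs_le. split; [|apply cauchy_schwarz].
  generalize (cauchy_schwarz (hopp x) y). rewrite re_opp_l, hnorm_opp. lra.
Qed.

Lemma cauchy_schwarz_abs_im x y : Rabs (im x y) <= hnorm x * hnorm y.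
Proof.
  replace (im x y) with (re ((0, -1) [*] x) y) by (ip_expand; ring).
  replace (hnorm x) with (hnorm ((0, -1) [*] x)).
  - apply cauchy_schwarz_abs.
  - apply hnorm_re_eq. ip_expand. ring.
Qed.

Lemma hnorm_triangle x y : hnorm (x [+] y) <= hnorm x + hnorm y.
Proof.
  generalize (hnorm_ge0 x) (hnorm_ge0 y) (cauchy_schwarz x y); intros Hx Hy H.
  apply sq_le_reg; [lra|]. rewrite hnorm_sq. ip_expand.
  rewrite (re_sym x y), <- !hnorm_sq. nra.
Qed.

Lemma hnorm_triangle_sub x y : hnorm (x [-] y) <= hnorm x + hnorm y.
Proof. rewrite <- (hnorm_opp y). apply hnorm_triangle. Qed.

Lemma hnorm_dist_triangle x y z : hnorm (x [-] z) <= hnorm (x [-] y) + hnorm (y [-] z).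
Proof.
  replace (x [-] z) with ((x [-] y) [+] (y [-] z)) by vec. apply hnorm_triangle.
Qed.

Lemma hnorm_dist_rev x y : hnorm x <= hnorm y + hnorm (x [-] y).
Proof.
  replace x with (y [+] (x [-] y)) at 1 by vec. apply hnorm_triangle.
Qed.

(** * Sequences *)

Definition hcauchy (u : nat -> X) : Prop :=
  forall eps, eps > 0 -> exists N, forall n m, (n >= N)%nat -> (m >= N)%nat ->
    hnorm (u n [-] u m) < eps.

Lemma hcauchy_conv (u : nat -> X) : hcauchy u -> exists l, hconv u l.
Proof. exact (hcomplete X u). Qed.

Lemma hconv_cauchy (u : nat -> X) l : hconv u l -> hcauchy u.
Proof.
  intros H eps He. destruct (H (eps / 2)) as [N HN]; [lra|].
  exists N. intros n m Hn Hm. specialize (HN n Hn) as H1. specialize (HN m Hm) as H2.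
  rewrite hnorm_sub_sym in H2. generalize (hnorm_dist_triangle (u n) l (u m)). lra.
Qed.

Lemma hconv_subseq (u : nat -> X) l phi :
  increasing phi -> hconv u l -> hconv (fun n => u (phi n)) l.
Proof.
  intros Hp H eps He. destruct (H eps He) as [N HN]. exists N. intros n Hn.
  apply HN. generalize (increasing_ge phi Hp n). lia.
Qed.

Lemma hcauchy_subseq (u : nat -> X) phi :
  increasing phi -> hcauchy u -> hcauchy (fun n => u (phi n)).
Proof.
  intros Hp H eps He. destruct (H eps He) as [N HN]. exists N. intros n m Hn Hm.
  apply HN; [generalize (increasing_ge phi Hp n)|generalize (increasing_ge phi Hp m)]; lia.
Qed.

Lemma hconv_of_bound (u : nat -> X) l :
  (forall n, hnorm (u n [-] l) <= / INR (S n)) -> hconv u l.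
Proof.
  intros H eps He. destruct (inv_INR_S_small eps He) as [N HN]. exists N. intros n Hn.
  apply Rle_lt_trans with (1 := H n). apply HN, Hn.
Qed.

Lemma hcauchy_dominated (u v : nat -> X) (K : R) :
  (forall n m, hnorm (u n [-] u m) <= K * hnorm (v n [-] v m)) -> hcauchy v -> hcauchy u.
Proof.
  intros H Hv eps He.
  (* [K] may be zero or negative, so it is replaced by a positive constant above it. *)
  assert (HK : 0 < Rabs K + 1) by (generalize (Rabs_pos K); lra).
  destruct (Hv (eps / (Rabs K + 1))) as [N HN]; [apply Rdiv_lt_0_compat; lra|].
  exists N. intros n m Hn Hm. specialize (HN n m Hn Hm).
  apply Rle_lt_trans with (1 := H n m).
  apply Rle_lt_trans with ((Rabs K + 1) * hnorm (v n [-] v m)).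
  - apply Rmult_le_compat_r; [apply hnorm_ge0|]. generalize (Rle_abs K). lra.
  - apply Rmult_lt_reg_l with (/ (Rabs K + 1)); [apply Rinv_0_lt_compat; lra|].
    rewrite <- Rmult_assoc, Rinv_l, Rmult_1_l by lra. unfold Rdiv in HN. lra.
Qed.

Lemma hcauchy_add (u v : nat -> X) :
  hcauchy u -> hcauchy v -> hcauchy (fun n => u n [+] v n).
Proof.
  intros Hu Hv eps He. destruct (Hu (eps / 2)) as [N1 H1]; [lra|].
  destruct (Hv (eps / 2)) as [N2 H2]; [lra|].
  exists (N1 + N2)%nat. intros n m Hn Hm.
  specialize (H1 n m ltac:(lia) ltac:(lia)). specialize (H2 n m ltac:(lia) ltac:(lia)).
  replace (u n [+] v n [-] (u m [+] v m)) with ((u n [-] u m) [+] (v n [-] v m)) by vec.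
  generalize (hnorm_triangle (u n [-] u m) (v n [-] v m)). lra.
Qed.

Lemma hcauchy_sub (u v : nat -> X) :
  hcauchy u -> hcauchy v -> hcauchy (fun n => u n [-] v n).
Proof.
  intros Hu Hv. apply (hcauchy_add u (fun n => hopp (v n))); [exact Hu|].
  apply (hcauchy_dominated _ v 1); [|exact Hv]. intros n m. rewrite Rmult_1_l. right.
  apply hnorm_re_eq. ip_expand. ring.
Qed.

Lemma hcauchy_bounded (u : nat -> X) : hcauchy u -> exists M, forall n, hnorm (u n) <= M.
Proof.
  intro H. destruct (H 1) as [N HN]; [lra|].
  assert (Hfin : forall K, exists M, forall n, (n < K)%nat -> hnorm (u n) <= M).
  { induction K as [|K [M HM]].
    - exists 0. intros; lia.
    - exists (Rmax M (hnorm (u K))). intros n Hn. destruct (Nat.eq_dec n K) as [->|E].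
      + apply Rmax_r.
      + apply Rle_trans with M; [apply HM; lia|apply Rmax_l]. }
  destruct (Hfin N) as [M HM]. exists (Rmax M (hnorm (u N) + 1)). intro n.
  destruct (Nat.le_gt_cases N n) as [Hn|Hn].
  - apply Rle_trans with (hnorm (u N) + 1); [|apply Rmax_r].
    specialize (HN n N Hn (le_n N)). generalize (hnorm_dist_rev (u n) (u N)). lra.
  - apply Rle_trans with M; [apply HM, Hn|apply Rmax_l].
Qed.

Lemma hconv_re (u : nat -> X) l y : hconv u l -> Un_cv (fun n => re (u n) y) (re l y).
Proof.
  intros H eps He. assert (Hy := hnorm_ge0 y).
  destruct (H (eps / (hnorm y + 1))) as [N HN]; [apply Rdiv_lt_0_compat; lra|].
  exists N. intros n Hn. unfold Rdist. rewrite <- re_sub_l.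
  apply Rle_lt_trans with (1 := cauchy_schwarz_abs _ _).
  specialize (HN n Hn). assert (H0 := hnorm_ge0 (u n [-] l)).
  apply Rle_lt_trans with (hnorm (u n [-] l) * (hnorm y + 1)); [nra|].
  apply Rmult_lt_compat_r with (r := hnorm y + 1) in HN; [|lra].
  unfold Rdiv in HN. rewrite Rmult_assoc, Rinv_l in HN by lra. lra.
Qed.

Lemma hconv_norm (u : nat -> X) l : hconv u l -> Un_cv (fun n => hnorm (u n)) (hnorm l).
Proof.
  intros H eps He. destruct (H eps He) as [N HN]. exists N. intros n Hn.
  unfold Rdist. specialize (HN n Hn).
  generalize (hnorm_dist_rev (u n) l) (hnorm_dist_rev l (u n)).
  rewrite (hnorm_sub_sym l). intros. apply Rabs_def1; lra.
Qed.

Lemma Un_cv_const (c : R) : Un_cv (fun _ => c) c.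
Proof. intros eps He. exists O. intros. unfold Rdist. rewrite Rminus_diag, Rabs_R0. lra. Qed.

Lemma hconv_re_const (u : nat -> X) l y c :
  hconv u l -> (forall n, re (u n) y = c) -> re l y = c.
Proof.
  intros H E. apply (UL_sequence (fun n => re (u n) y)); [apply hconv_re, H|].
  intros eps He. exists O. intros n _. rewrite E. unfold Rdist.
  rewrite Rminus_diag, Rabs_R0. lra.
Qed.

(** * Orthogonal projections *)

Definition is_vsubspace (W : X -> Prop) : Prop :=
  W hzero /\ (forall x y, W x -> W y -> W (x [+] y)) /\ (forall a x, W x -> W (a [*] x)).

Lemma vsubspace_sub (W : X -> Prop) x y : is_vsubspace W -> W x -> W y -> W (x [-] y).
Proof.
  intros [_ [HD HZ]] Hx Hy. replace (x [-] y) with (x [+] ((-1, 0) [*] y)) by vec.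
  apply HD, HZ; assumption.
Qed.

(** The infimum is minus the supremum of the reflected set. *)
Lemma nonneg_inf_exists (E : R -> Prop) :
  (exists a, E a) -> (forall a, E a -> 0 <= a) ->
  exists d, (forall a, E a -> d <= a) /\ forall eps, eps > 0 -> exists a, E a /\ a < d + eps.
Proof.
  intros [a0 Ha0] Hpos.
  destruct (completeness (fun b => E (- b))) as [m [Hub Hlub]].
  - exists 0. intros b Hb. specialize (Hpos _ Hb). lra.
  - exists (- a0). rewrite Ropp_involutive. exact Ha0.
  - exists (- m). split.
    + intros a Ha. rewrite <- (Ropp_involutive a) in Ha. specialize (Hub _ Ha). lra.
    + intros eps He. apply NNPP. intro Hno.
      assert (m <= m - eps); [|lra]. apply Hlub. intros b Hb.
      apply Rnot_lt_le. intro Hlt. apply Hno. exists (- b). split; [exact Hb|lra].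
Qed.

Lemma quadratic_nonneg_lin0 (b q : R) : (forall t, 0 <= - 2 * t * b + t * t * q) -> b = 0.
Proof.
  intro H. destruct (Req_dec b 0) as [|Hb]; [assumption|exfalso].
  assert (Hbb : 0 < b * b) by nra.
  destruct (Rle_lt_dec q 0) as [Hq|Hq].
  - specialize (H b). nra.
  (* The minimum of the quadratic is at [b / q], with value [- b^2 / q]. *)
  - specialize (H (b / q)).
    replace (-2 * (b / q) * b + b / q * (b / q) * q) with (- (b * b) / q) in H by (field; lra).
    assert (0 < b * b / q) by (apply Rdiv_lt_0_compat; lra).
    replace (- (b * b) / q) with (- (b * b / q)) in H by (field; lra). lra.
Qed.

(** [W] is often a range not known to be closed, so [p] lies in its closure and comes with an
    approximating sequence. A minimizing sequence for the distance from [x] is Cauchy by the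
    parallelogram law. *)
Lemma projection_closure (W : X -> Prop) x :
  is_vsubspace W ->
  exists p (w : nat -> X), (forall n, W (w n)) /\ hconv w p /\
    forall v, W v -> hinner (x [-] p) v = C0.
Proof.
  intros [W0 [WD WZ]].
  destruct (nonneg_inf_exists (fun a => exists v, W v /\ a = re (x [-] v) (x [-] v)))
    as [d [Hd Happ]].
  { exists (re (x [-] hzero) (x [-] hzero)), hzero. auto. }
  { intros a [v [_ ->]]. apply re_diag_ge0. }
  assert (Hw : forall n, exists v, W v /\ re (x [-] v) (x [-] v) < d + / INR (S n)).
  { intro n. destruct (Happ _ (INR_S_inv_pos n)) as [a [[v [Hv ->]] Hlt]]. eauto. }
  apply choice_fun in Hw. destruct Hw as [w Hw].
  assert (Hlow : forall v, W v -> d <= re (x [-] v) (x [-] v)) by (intros v Hv; apply Hd; eauto).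
  assert (Hc : hcauchy w).
  { intros eps He. destruct (inv_INR_S_small (eps * eps / 4)) as [N HN]; [nra|].
    exists N. intros n m Hn Hm. apply sq_lt_reg; [lra|]. rewrite hnorm_sq.
    (* The midpoint is in [W], hence at squared distance at least [d] from [x]; this bounds the
       parallelogram identity by four times [eps^2 / 4]. *)
    assert (Hmid : W ((1 / 2, 0) [*] (w n [+] w m))) by (apply WZ, WD; apply Hw).
    apply Hlow in Hmid.
    assert (Epar : re (w n [-] w m) (w n [-] w m) =
      2 * re (x [-] w n) (x [-] w n) + 2 * re (x [-] w m) (x [-] w m)
      - 4 * re (x [-] (1 / 2, 0) [*] (w n [+] w m)) (x [-] (1 / 2, 0) [*] (w n [+] w m))).
    { ip_expand. rewrite (re_sym x (w n)), (re_sym x (w m)), (re_sym (w n) (w m)). field. }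
    destruct (Hw n) as [_ H1], (Hw m) as [_ H2].
    specialize (HN n Hn) as H3. specialize (HN m Hm) as H4. lra. }
  destruct (hcauchy_conv w Hc) as [p Hp].
  assert (Hre : forall v, W v -> re (x [-] p) v = 0).
  (* Moving [w n] by [t v] stays in [W], so it lowers the squared distance by less than
     [/ INR (S n)]. In the limit a quadratic in [t] is nonnegative, and its linear coefficient
     vanishes. *)
  { intros v Hv. apply quadratic_nonneg_lin0 with (re v v). intro t.
    apply Rle_cv_lim with (Un := fun n => - / INR (S n))
      (Vn := fun n => - 2 * t * (re x v - re (w n) v) + t * t * re v v).
    - intro n. destruct (Hw n) as [Hwn Hn].
      assert (Hlt := Hlow (w n [+] (t, 0) [*] v) ltac:(auto)).
      revert Hlt Hn. ip_expand. rewrite (re_sym x (w n)), (re_sym x v), (re_sym (w n) v).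
      lra.
    - replace 0 with (- 0) by ring. apply CV_opp. intros eps He.
      destruct (inv_INR_S_small eps He) as [N HN]. exists N. intros n Hn. unfold Rdist.
      rewrite Rminus_0_r, Rabs_pos_eq; [apply HN, Hn|apply Rlt_le, INR_S_inv_pos].
    - rewrite re_sub_l.
      apply (CV_plus (fun n => - 2 * t * (re x v - re (w n) v)) (fun _ => t * t * re v v));
        [|apply Un_cv_const].
      apply (CV_mult (fun _ => - 2 * t) (fun n => re x v - re (w n) v)); [apply Un_cv_const|].
      apply (CV_minus (fun _ => re x v) (fun n => re (w n) v)); [apply Un_cv_const|].
      apply hconv_re, Hp. }
  exists p, w. split; [apply Hw|]. split; [exact Hp|].
  intros v Hv. apply hinner_eq0. split; [apply Hre, Hv|].
  specialize (Hre ((0, 1) [*] v) (WZ _ _ Hv)). revert Hre. ip_expand. lra.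
Qed.
End Topology.

(** * Finite-dimensional subspaces *)

Section FiniteDimension.
Context {X : CHilbert}.
Implicit Types x y z f g h p : X.
Implicit Types v w : nat -> X.

Definition independent (v : nat -> X) (n : nat) : Prop :=
  forall c : nat -> C, lin_comb c v n = hzero -> forall i, (i < n)%nat -> c i = C0.

(** Phrased so that [infinite_multiplicity T lam] unfolds to [inf_dim] of the eigenspace. *)
Definition inf_dim (W : X -> Prop) : Prop :=
  forall n : nat, exists v : nat -> X, (forall i, (i < n)%nat -> W (v i)) /\ independent v n.

Lemma lin_comb_ext (c d : nat -> C) (v w : nat -> X) n :
  (forall i, (i < n)%nat -> c i = d i /\ v i = w i) -> lin_comb c v n = lin_comb d w n.
Proof.
  intro H. induction n as [|n IH]; [reflexivity|]. simpl.
  rewrite IH by (intros; apply H; lia).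
  destruct (H n) as [-> ->]; [lia|reflexivity].
Qed.

Lemma lin_comb_in (W : X -> Prop) c v n :
  is_vsubspace W -> (forall i, (i < n)%nat -> W (v i)) -> W (lin_comb c v n).
Proof.
  intros [W0 [WD WZ]] H. induction n as [|n IH]; simpl; [exact W0|].
  apply WD; [apply IH; intros; apply H; lia|apply WZ, H; lia].
Qed.

Lemma span_vsubspace v n : is_vsubspace (fun x => exists c, x = lin_comb c v n).
Proof.
  split; [|split].
  - exists (fun _ => C0). induction n as [|n IH]; [reflexivity|]. simpl. rewrite <- IH. vec.
  - intros x y [c ->] [d ->]. exists (fun i => Cadd (c i) (d i)).
    induction n as [|n IH]; simpl; [vec|]. rewrite <- IH. vec.
  - intros a x [c ->]. exists (fun i => Cmul a (c i)).
    induction n as [|n IH]; simpl; [vec|]. rewrite <- IH. vec.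
Qed.

(** Families of length [n] are total functions of which only the values below [n] count, so
    overwriting entry [n] appends an element. *)
Definition put {U : Type} (c : nat -> U) (n : nat) (a : U) : nat -> U :=
  fun i => if Nat.eqb i n then a else c i.

Lemma put_eq {U : Type} (c : nat -> U) n a : put c n a n = a.
Proof. unfold put. rewrite Nat.eqb_refl. reflexivity. Qed.

Lemma put_lt {U : Type} (c : nat -> U) n a i : (i < n)%nat -> put c n a i = c i.
Proof. intro H. unfold put. rewrite (proj2 (Nat.eqb_neq i n)) by lia. reflexivity. Qed.

Lemma lin_comb_put_coef c v n a :
  lin_comb (put c n a) v (S n) = lin_comb c v n [+] a [*] v n.
Proof.
  simpl. rewrite put_eq. f_equal. apply lin_comb_ext. intros i Hi.
  split; [apply put_lt, Hi|reflexivity].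
Qed.

Lemma lin_comb_put_vec c v n x :
  lin_comb c (put v n x) (S n) = lin_comb c v n [+] c n [*] x.
Proof.
  simpl. rewrite put_eq. f_equal. apply lin_comb_ext. intros i Hi.
  split; [reflexivity|apply put_lt, Hi].
Qed.

Lemma independent_prefix v n : independent v (S n) -> independent v n.
Proof.
  intros H c Hc i Hi. rewrite <- (put_lt c n C0 i Hi). apply H; [|lia].
  rewrite lin_comb_put_coef, Hc. vec.
Qed.

(** Pairing with [y] is one linear functional, so its kernel has codimension at most one in the
    span. If the last vector is orthogonal to [y], it is kept and the others are treated by
    induction; otherwise multiples of it are subtracted from the others. *)
Lemma independent_orthogonalize y n : forall v, independent v (S n) ->
  exists w, independent w n /\
    (forall i, (i < n)%nat -> exists c, w i = lin_comb c v (S n)) /\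
    (forall i, (i < n)%nat -> hinner (w i) y = C0).
Proof.
  induction n as [|n IH]; intros v Hv.
  { exists v. split; [|split]; intros; try lia. intros c _ i Hi. lia. }
  set (last := v (S n)). destruct (classic (hinner last y = C0)) as [E|E].
  - destruct (IH v (independent_prefix _ _ Hv)) as [w [Hw [Hspan Horth]]].
    exists (put w n last). split; [|split].
    + intros c Hc. rewrite lin_comb_put_vec in Hc.
      destruct (lin_comb_in _ c w n (span_vsubspace v (S n)) Hspan) as [d Hd].
      assert (Hcn : c n = C0).
      { rewrite <- (put_eq d (S n) (c n)). apply Hv; [|lia].
        rewrite lin_comb_put_coef, <- Hd. exact Hc. }
      rewrite Hcn in Hc.
      assert (Hc' : lin_comb c w n = hzero) by (rewrite <- Hc; vec).
      intros i Hi. destruct (Nat.eq_dec i n) as [->|Hne]; [exact Hcn|].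
      apply (Hw c Hc'). lia.
    + intros i Hi. destruct (Nat.eq_dec i n) as [->|Hne].
      * rewrite put_eq. exists (put (fun _ => C0) (S n) C1). rewrite lin_comb_put_coef.
        replace (lin_comb (fun _ => C0) v (S n)) with (hzero : X); [unfold last; vec|].
        generalize (S n); intro m. induction m as [|m IHm]; [reflexivity|].
        simpl. rewrite <- IHm. vec.
      * rewrite put_lt by lia. destruct (Hspan i) as [d Hd]; [lia|].
        exists (put d (S n) C0). rewrite lin_comb_put_coef, <- Hd. vec.
    + intros i Hi. destruct (Nat.eq_dec i n) as [->|Hne].
      * rewrite put_eq. exact E.
      * rewrite put_lt by lia. apply Horth. lia.
  - set (b1 := re last y). set (b2 := im last y). set (q := b1 * b1 + b2 * b2).
    assert (Hq : q <> 0).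
    { intro Hq. apply E, hinner_eq0. unfold q in Hq. fold b1 b2. split; nra. }
    (* The complex quotient of the pairings of [v i] and [last] with [y]. *)
    set (a := fun i => ((re (v i) y * b1 + im (v i) y * b2) / q,
                        (im (v i) y * b1 - re (v i) y * b2) / q) : C).
    exists (fun i => v i [-] a i [*] last). split; [|split].
    + intros c Hc.
      (* The subtractions alter a combination only by a multiple of [last], so a vanishing
         combination extends to one of the original family. *)
      assert (Hk : forall m, exists k,
        lin_comb c (fun i => v i [-] a i [*] last) m = lin_comb c v m [+] k [*] last).
      { induction m as [|m [k Hk]]; [exists C0; simpl; vec|].
        exists (Csub k (Cmul (c m) (a m))). simpl. rewrite Hk. vec. }
      destruct (Hk (S n)) as [k Hk']. rewrite Hk' in Hc.
      intros i Hi. rewrite <- (put_lt c (S n) k i Hi). apply Hv; [|lia].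
      rewrite lin_comb_put_coef. exact Hc.
    + assert (Hgen : forall i, (i < S (S n))%nat -> exists c, v i = lin_comb c v (S (S n))).
      { intros i Hi. generalize (S (S n)) Hi. intros m. induction m as [|m IHm]; intro Hm; [lia|].
        destruct (Nat.eq_dec i m) as [->|Hne].
        - destruct (span_vsubspace v m) as [[d Hd] _]. exists (put d m C1).
          rewrite lin_comb_put_coef, <- Hd. vec.
        - destruct IHm as [d Hd]; [lia|]. exists (put d m C0).
          rewrite lin_comb_put_coef, <- Hd. vec. }
      intros i Hi. apply (vsubspace_sub (fun x => exists c, x = lin_comb c v (S (S n)))).
      * apply span_vsubspace.
      * apply Hgen. lia.
      * apply span_vsubspace, Hgen. lia.
    + intros i Hi. apply hinner_eq0. ip_expand. unfold a, last. cbn [fst snd].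
      fold last. fold b1 b2. unfold q in *. split; field; exact Hq.
Qed.

Lemma inf_dim_orthogonal (W : X -> Prop) y :
  is_vsubspace W -> inf_dim W -> inf_dim (fun x => W x /\ hinner x y = C0).
Proof.
  intros HW Hinf n. destruct (Hinf (S n)) as [v [Hv Hind]].
  destruct (independent_orthogonalize y n v Hind) as [w [Hw [Hspan Horth]]].
  exists w. split; [|exact Hw]. intros i Hi. split; [|apply Horth, Hi].
  destruct (Hspan i Hi) as [c ->]. apply lin_comb_in; assumption.
Qed.

Lemma vsubspace_orthogonal (W : X -> Prop) y :
  is_vsubspace W -> is_vsubspace (fun x => W x /\ hinner x y = C0).
Proof.
  intros [W0 [WD WZ]]. split; [|split].
  - split; [exact W0|]. apply hinner_eq0. ip_expand. auto.
  - intros x z [Hx Hxy] [Hz Hzy]. split; [auto|].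
    apply hinner_eq0 in Hxy, Hzy. apply hinner_eq0. ip_expand. lra.
  - intros a x [Hx Hxy]. split; [auto|].
    apply hinner_eq0 in Hxy. apply hinner_eq0. ip_expand. destruct Hxy as [-> ->]. lra.
Qed.

Lemma normalize_unit x : x <> hzero -> hnorm ((/ hnorm x, 0) [*] x) = 1.
Proof.
  intro Hx. assert (Hpos : 0 < hnorm x).
  { destruct (hnorm_ge0 x) as [H|H]; [exact H|]. exfalso. apply Hx, hnorm_eq0. auto. }
  rewrite hnorm_rscal, Rabs_pos_eq; [apply Rinv_l; lra|].
  apply Rlt_le, Rinv_0_lt_compat, Hpos.
Qed.

(** Each vector of the list costs at most one dimension, so an infinite-dimensional space survives
    finitely many orthogonality conditions. *)
Lemma inf_dim_unit_orthogonal (l : list X) : forall W : X -> Prop,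
  is_vsubspace W -> inf_dim W ->
  exists e, W e /\ hnorm e = 1 /\ forall y, In y l -> hinner e y = C0.
Proof.
  induction l as [|y l IH]; intros W HW Hinf.
  - destruct (Hinf 1%nat) as [v [Hv Hind]].
    assert (H0 : v O <> hzero).
    { intro E. specialize (Hind (fun _ => C1)). simpl in Hind. rewrite E in Hind.
      assert (F : C1 = C0) by (apply (Hind ltac:(vec) O); lia).
      apply (f_equal fst) in F. simpl in F. lra. }
    exists ((/ hnorm (v O), 0) [*] v O). split; [|split].
    + apply HW, Hv. lia.
    + apply normalize_unit, H0.
    + intros y [].
  - destruct (IH _ (vsubspace_orthogonal W y HW) (inf_dim_orthogonal W y HW Hinf))
      as [e [[He Hey] [Hn Hl]]].
    exists e. split; [exact He|]. split; [exact Hn|]. intros z [<-|Hz]; auto.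
Qed.

(** An orthonormal sequence is chosen greedily, [L n] listing the vectors chosen before step [n].
    Distinct members are at distance [sqrt 2]. *)
Lemma inf_dim_no_cauchy (W : X -> Prop) :
  is_vsubspace W -> inf_dim W ->
  exists e : nat -> X, (forall n, W (e n)) /\ (forall n, hnorm (e n) = 1) /\
    forall phi, increasing phi -> ~ hcauchy (fun n => e (phi n)).
Proof.
  intros HW Hinf.
  destruct (choice_fun _ (fun l => inf_dim_unit_orthogonal l W HW Hinf)) as [g Hg].
  set (L := fix L n := match n with O => nil | S k => g (L k) :: L k end).
  assert (HL : forall n k, (k < n)%nat -> In (g (L k)) (L n)).
  { induction n as [|n IH]; intros k Hk; [lia|]. destruct (Nat.eq_dec k n) as [->|Hne].
    - left. reflexivity.
    - right. apply IH. lia. }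
  exists (fun n => g (L n)). split; [|split].
  - intro n. apply Hg.
  - intro n. apply Hg.
  - intros phi Hphi Hc. destruct (Hc 1 ltac:(lra)) as [N HN].
    specialize (HN (S N) N ltac:(lia) ltac:(lia)).
    assert (Horth : hinner (g (L (phi (S N)))) (g (L (phi N))) = C0).
    { apply Hg, HL, Hphi. }
    apply hinner_eq0 in Horth. destruct Horth as [Horth _].
    destruct (Hg (L (phi (S N)))) as [_ [H1 _]], (Hg (L (phi N))) as [_ [H2 _]].
    assert (Hsq := hnorm_sq (g (L (phi (S N))) [-] g (L (phi N)))). revert Hsq.
    ip_expand. rewrite (re_sym (g (L (phi (S N)))) (g (L (phi N)))), Horth, <- !hnorm_sq, H1, H2.
    generalize (hnorm_ge0 (g (L (phi (S N))) [-] g (L (phi N)))). nra.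
Qed.

(** Bolzano-Weierstrass in dimension below [n]. The induction splits off a unit vector [e]:
    components orthogonal to [e] live in smaller dimension, and coefficients along [e] are bounded
    scalars. *)
Lemma fin_dim_subseq_cauchy n : forall W : X -> Prop,
  is_vsubspace W ->
  ~ (exists v, (forall i, (i < n)%nat -> W (v i)) /\ independent v n) ->
  forall (x : nat -> X) (M : R), (forall k, W (x k)) -> (forall k, hnorm (x k) <= M) ->
  exists phi, increasing phi /\ hcauchy (fun k => x (phi k)).
Proof.
  induction n as [|n IH]; intros W HW Hno x M Hx HM.
  { exfalso. apply Hno. exists x. split; [intros; lia|]. intros c _ i Hi. lia. }
  destruct (classic (forall y, W y -> y = hzero)) as [Htriv|Hnt].
  { exists (fun k => k). split; [intro k; lia|]. intros eps He. exists O. intros k m _ _.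
    rewrite (Htriv _ (Hx k)), (Htriv _ (Hx m)).
    replace (hzero [-] hzero) with (hzero : X) by vec. rewrite hnorm_zero. lra. }
  assert (He : exists e, W e /\ hnorm e = 1).
  { apply not_all_ex_not in Hnt. destruct Hnt as [y Hy]. apply imply_to_and in Hy.
    exists ((/ hnorm y, 0) [*] y). split; [apply HW, Hy|apply normalize_unit, Hy]. }
  destruct He as [e [We He]].
  assert (Hee : re e e = 1) by (rewrite <- hnorm_sq, He; ring).
  set (x' := fun k => x k [-] (re (x k) e, im (x k) e) [*] e).
  assert (Hpyth : forall k, hnorm (x' k) <= hnorm (x k)).
  { intro k. apply sq_le_reg; [apply hnorm_ge0|]. rewrite !hnorm_sq. unfold x'. ip_expand.
    rewrite (re_sym (x k) e), (im_sym (x k) e), Hee. nra. }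
  destruct (IH (fun y => W y /\ hinner y e = C0)) with (x := x') (M := M) as [phi [Hphi Hcau]].
  - apply vsubspace_orthogonal, HW.
  (* Appending [e] to an independent family orthogonal to [e] keeps it independent. *)
  - intros [v [Hv Hind]]. apply Hno. exists (put v n e). split.
    + intros i Hi. destruct (Nat.eq_dec i n) as [->|Hne]; [rewrite put_eq; exact We|].
      rewrite put_lt by lia. apply Hv. lia.
    + intros c Hc. rewrite lin_comb_put_vec in Hc.
      assert (H0 : (fun y => True /\ hinner y e = C0) (lin_comb c v n)).
      { apply lin_comb_in.
        - apply (vsubspace_orthogonal (fun _ => True)). repeat split.
        - intros i Hi. split; [exact I|apply Hv, Hi]. }
      destruct H0 as [_ H0]. apply hinner_eq0 in H0. destruct H0 as [H0r H0i].
      assert (Hcn : c n = C0).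
      { assert (F : re (lin_comb c v n [+] c n [*] e) e = 0) by (rewrite Hc; apply re_zero_l).
        assert (G : im (lin_comb c v n [+] c n [*] e) e = 0) by (rewrite Hc; apply im_zero_l).
        revert F G. ip_expand. rewrite H0r, H0i, Hee. intros F G.
        apply Cpair_eq; simpl; lra. }
      rewrite Hcn in Hc.
      assert (Hc' : lin_comb c v n = hzero) by (rewrite <- Hc; vec).
      intros i Hi. destruct (Nat.eq_dec i n) as [->|Hne]; [exact Hcn|].
      apply (Hind c Hc'). lia.
  - intro k. split.
    + apply vsubspace_sub; [exact HW|apply Hx|apply HW, We].
    + apply hinner_eq0. unfold x'. ip_expand. rewrite Hee. lra.
  - intro k. apply Rle_trans with (hnorm (x k)); auto.
  - destruct (bounded_subseq_cv (fun k => re (x (phi k)) e) M) as [psi [a [Hpsi Ha]]].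
    { intro k. apply Rle_trans with (1 := cauchy_schwarz_abs _ _). rewrite He, Rmult_1_r. auto. }
    destruct (bounded_subseq_cv (fun k => im (x (phi (psi k))) e) M) as [chi [b [Hchi Hb]]].
    { intro k. apply Rle_trans with (1 := cauchy_schwarz_abs_im _ _). rewrite He, Rmult_1_r. auto. }
    (* Three extractions: the orthogonal component, then the real and the imaginary part of the
       coefficient. *)
    set (th := fun k => phi (psi (chi k))).
    assert (Hth : increasing th).
    { apply (increasing_comp phi (fun k => psi (chi k))); [exact Hphi|].
      apply increasing_comp; assumption. }
    exists th. split; [exact Hth|].
    assert (Hca : hcauchy (fun k => (re (x (th k)) e, im (x (th k)) e) [*] e)).
    { apply (hconv_cauchy _ ((a, b) [*] e)). intros eps Heps.
      destruct (Ha (eps / 2)) as [N1 H1]; [lra|]. destruct (Hb (eps / 2)) as [N2 H2]; [lra|].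
      exists (N1 + N2)%nat. intros k Hk.
      assert (Hgk : (chi k >= N1)%nat) by (generalize (increasing_ge chi Hchi k); lia).
      specialize (H1 _ Hgk). specialize (H2 k ltac:(lia)). unfold Rdist in H1, H2.
      fold (th k) in H1, H2.
      apply Rle_lt_trans with (Rabs (re (x (th k)) e - a) + Rabs (im (x (th k)) e - b)); [|lra].
      assert (P1 := Rabs_pos (re (x (th k)) e - a)). assert (P2 := Rabs_pos (im (x (th k)) e - b)).
      apply sq_le_reg; [lra|]. rewrite hnorm_sq. ip_expand. rewrite Hee.
      assert (Q : forall r, Rabs r * Rabs r = r * r) by (intro r; exact (eq_sym (Rsqr_abs r))).
      assert (Q1 := Q (re (x (th k)) e - a)). assert (Q2 := Q (im (x (th k)) e - b)). nra. }
    apply (hcauchy_add (fun k => x' (th k))) in Hca.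
    + intros eps Heps. destruct (Hca eps Heps) as [N HN]. exists N. intros k m Hk Hm.
      specialize (HN k m Hk Hm). unfold x' in HN.
      replace (x (th k) [-] x (th m)) with
        (x (th k) [-] (re (x (th k)) e, im (x (th k)) e) [*] e
         [+] (re (x (th k)) e, im (x (th k)) e) [*] e
         [-] (x (th m) [-] (re (x (th m)) e, im (x (th m)) e) [*] e [+]
              (re (x (th m)) e, im (x (th m)) e) [*] e)) by vec.
      exact HN.
    + apply (hcauchy_subseq (fun k => x' (phi k)) (fun k => psi (chi k))); [|exact Hcau].
      apply increasing_comp; assumption.
Qed.

End FiniteDimension.

(** * Spectra of self-adjoint relations *)

Section Relations.
Context {X : CHilbert}.
Implicit Types x y z f g h p : X.
Implicit Types T : @rel X.

(** This is [T - a]: the pair [(x, f)] of [T] becomes [(x, f - a x)]. The sign is opposite to that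
    of [lambda I - T] in [resolvent]. *)
Definition shift T (a : C) : @rel X := fun x g => T x (g [+] a [*] x).

(** The constant multiplies the image, as in [resolvent]: the inverse is single-valued and bounded
    on the range. *)
Definition bounded_below T : Prop :=
  exists k, forall x f, T x f -> hnorm x <= k * hnorm f.

Definition conv_closed T : Prop :=
  forall (x f : nat -> X) x0 f0,
    (forall n, T (x n) (f n)) -> hconv x x0 -> hconv f f0 -> T x0 f0.

(* With [T] replaced by [shift T a], this says that [T - a] has closed range and
   finite-dimensional kernel. *)
Definition proper T : Prop :=
  forall (x f : nat -> X) (M : R),
    (forall n, T (x n) (f n)) -> (forall n, hnorm (x n) <= M) -> hcauchy f ->
    exists phi, increasing phi /\ hcauchy (fun n => x (phi n)).

Lemma subspace_sub T x f y g : is_subspace T -> T x f -> T y g -> T (x [-] y) (f [-] g).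
Proof.
  intros [_ [HD HZ]] Hx Hy.
  replace (x [-] y) with (x [+] ((-1, 0) [*] y)) by vec.
  replace (f [-] g) with (f [+] ((-1, 0) [*] g)) by vec.
  apply HD, HZ; assumption.
Qed.

Lemma kernel_vsubspace T : is_subspace T -> is_vsubspace (fun x => T x hzero).
Proof.
  intros [H0 [HD HZ]]. split; [|split].
  - exact H0.
  - intros x y Hx Hy. rewrite <- (hadd_zero X hzero). auto.
  - intros a x Hx. replace (hzero : X) with (a [*] hzero : X) by vec. auto.
Qed.

Lemma range_vsubspace T : is_subspace T -> is_vsubspace (fun f => exists x, T x f).
Proof.
  intros [H0 [HD HZ]]. split; [|split].
  - exists hzero. exact H0.
  - intros f g [x Hx] [y Hy]. exists (x [+] y). auto.
  - intros a f [x Hx]. exists (a [*] x). auto.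
Qed.

Lemma is_closed_conv T : is_closed T -> conv_closed T.
Proof.
  intros H x f x0 f0 HT Hx Hf. apply (H x f x0 f0 HT). intros eps He.
  destruct (Hx (eps / 2)) as [N1 H1]; [lra|]. destruct (Hf (eps / 2)) as [N2 H2]; [lra|].
  exists (N1 + N2)%nat. intros n Hn.
  specialize (H1 n ltac:(lia)). specialize (H2 n ltac:(lia)).
  apply Rle_lt_trans with (hnorm (x n [-] x0) + hnorm (f n [-] f0)); [|lra].
  assert (P1 := hnorm_ge0 (x n [-] x0)). assert (P2 := hnorm_ge0 (f n [-] f0)).
  assert (Q1 := hnorm_sq (x n [-] x0)). assert (Q2 := hnorm_sq (f n [-] f0)).
  apply sq_le_reg; [lra|]. unfold norm2, inner2. cbn [fst Cadd].
  fold (re (x n [-] x0) (x n [-] x0)). fold (re (f n [-] f0) (f n [-] f0)).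
  rewrite sqrt_sqrt by nra. nra.
Qed.

(** An adjoint is cut out by equations between inner products, each preserved in the limit.
    Imaginary parts are reduced to real ones by multiplying the test pair by [i]. *)
Lemma selfadjoint_conv_closed T : is_selfadjoint T -> conv_closed T.
Proof.
  intros HT x f x0 f0 Hn Hx Hf. apply HT. intros y g Hyg.
  assert (E : forall n, hinner (f n) y = hinner (x n) g).
  { intro n. apply (proj1 (HT _ _) (Hn n)), Hyg. }
  assert (Hgen : forall y' g', (forall n, re (f n) y' = re (x n) g') -> re f0 y' = re x0 g').
  { intros y' g' E'. apply (UL_sequence (fun n => re (f n) y')); [apply hconv_re, Hf|].
    intros eps He. destruct (hconv_re x x0 g' Hx eps He) as [N HN].
    exists N. intros n Hn'. rewrite E'. apply HN, Hn'. }
  apply hinner_eqP. split.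
  - apply Hgen. intro n. apply hinner_eqP, E.
  - assert (F : re f0 ((0, 1) [*] y) = re x0 ((0, 1) [*] g)).
    { apply Hgen. intro n. ip_expand. destruct (proj1 (hinner_eqP _ _ _ _) (E n)). lra. }
    revert F. ip_expand. lra.
Qed.

Lemma shift_subspace T a : is_subspace T -> is_subspace (shift T a).
Proof.
  intros [H0 [HD HZ]]. unfold shift. split; [|split].
  - replace (hzero [+] a [*] hzero) with (hzero : X) by vec. exact H0.
  - intros x f y g Hx Hy. replace (f [+] g [+] a [*] (x [+] y))
      with ((f [+] a [*] x) [+] (g [+] a [*] y)) by vec. auto.
  - intros b x f Hx. replace (b [*] f [+] a [*] (b [*] x)) with (b [*] (f [+] a [*] x)) by vec.
    auto.
Qed.

Lemma shift_conv_closed T a : conv_closed T -> conv_closed (shift T a).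
Proof.
  intros HT x f x0 f0 Hn Hx Hf. apply (HT x (fun n => f n [+] a [*] x n)); auto.
  intros eps He. assert (Ha : 0 < Rabs (fst a) + Rabs (snd a) + 1).
  { generalize (Rabs_pos (fst a)) (Rabs_pos (snd a)). lra. }
  destruct (Hf (eps / 2)) as [N1 H1]; [lra|].
  destruct (Hx (eps / 2 / (Rabs (fst a) + Rabs (snd a) + 1))) as [N2 H2].
  { apply Rdiv_lt_0_compat; lra. }
  exists (N1 + N2)%nat. intros n Hnn.
  specialize (H1 n ltac:(lia)). specialize (H2 n ltac:(lia)).
  (* The scalar [a] is split into real and imaginary parts so that [hnorm_rscal] applies to each. *)
  replace (f n [+] a [*] x n [-] (f0 [+] a [*] x0))
    with ((f n [-] f0) [+] ((fst a, 0) [*] (x n [-] x0)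
          [+] (snd a, 0) [*] ((0, 1) [*] (x n [-] x0)))) by vec.
  apply Rle_lt_trans with (1 := hnorm_triangle _ _).
  assert (E := hnorm_triangle ((fst a, 0) [*] (x n [-] x0))
    ((snd a, 0) [*] ((0, 1) [*] (x n [-] x0)))).
  rewrite !hnorm_rscal in E.
  assert (F : hnorm ((0, 1) [*] (x n [-] x0)) = hnorm (x n [-] x0)).
  { apply hnorm_re_eq. ip_expand. ring. }
  rewrite F in E.
  apply Rmult_lt_compat_r with (r := Rabs (fst a) + Rabs (snd a) + 1) in H2; [|lra].
  unfold Rdiv in H2. rewrite Rmult_assoc, Rinv_l in H2 by lra.
  generalize (hnorm_ge0 (x n [-] x0)). lra.
Qed.

Lemma shift_selfadjoint T (c : R) : is_selfadjoint T -> is_selfadjoint (shift T (c, 0)).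
Proof.
  intros HT x f. unfold shift. rewrite (HT x). split; intros H y g Hyg.
  - specialize (H y _ Hyg). revert H. rewrite !hinner_eqP. ip_expand. lra.
  - specialize (H y (g [-] (c, 0) [*] y)). revert H. rewrite !hinner_eqP. ip_expand.
    replace (g [-] (c, 0) [*] y [+] (c, 0) [*] y) with g by vec. intro H.
    specialize (H Hyg). lra.
Qed.

Lemma shift_shift T (a b : R) x f :
  shift (shift T (a, 0)) (b, 0) x f <-> shift T (a + b, 0) x f.
Proof.
  unfold shift.
  replace (f [+] (b, 0) [*] x [+] (a, 0) [*] x) with (f [+] (a + b, 0) [*] x) by vec.
  reflexivity.
Qed.

Lemma bounded_below_shift_shift T (a b : R) :
  bounded_below (shift T (a + b, 0)) -> bounded_below (shift (shift T (a, 0)) (b, 0)).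
Proof. intros [k Hk]. exists k. intros x f H. apply Hk, shift_shift, H. Qed.

(** * Ranges and the resolvent set *)

Lemma bounded_below_surjective T :
  is_subspace T -> conv_closed T -> bounded_below T ->
  (forall y, (forall x f, T x f -> hinner y f = C0) -> y = hzero) ->
  forall y, exists x, T x y.
Proof.
  intros HS HC [k Hk] Hdense y.
  (* By density [y] is a limit of images; their preimages are Cauchy by the lower bound, and
     closedness places the limit pair in [T]. *)
  destruct (projection_closure (fun f => exists x, T x f) y) as [p [f [Hf [Hp Horth]]]].
  { apply range_vsubspace, HS. }
  assert (Eyp : y = p).
  { apply hsub_eq0, Hdense. intros x g Hg. apply Horth. exists x. exact Hg. }
  apply choice_fun in Hf. destruct Hf as [x Hx].
  destruct (hcauchy_conv x) as [x0 Hx0].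
  { apply (hcauchy_dominated x f k); [|apply (hconv_cauchy f p Hp)].
    intros n m. apply Hk, subspace_sub; auto. }
  exists x0. rewrite Eyp. apply (HC x f); auto.
Qed.

Lemma selfadjoint_resolvent T (a : C) :
  is_subspace T -> is_selfadjoint T ->
  bounded_below (shift T a) -> bounded_below (shift T (Cconj a)) -> resolvent T a.
Proof.
  intros HS HT [k Hk] [k' Hk'].
  assert (Hsurj : forall y, exists x, shift T a x y).
  { apply bounded_below_surjective.
    - apply shift_subspace, HS.
    - apply shift_conv_closed, selfadjoint_conv_closed, HT.
    - exists k. exact Hk.
    (* A vector orthogonal to the range of [T - a] lies in the kernel of [T - Cconj a], which is
       trivial by the second lower bound. *)
    - intros y Hy. assert (Hadj : T y (hzero [+] Cconj a [*] y)).
      { apply HT. intros x f Hxf.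
        assert (H0 : hinner y (f [-] a [*] x) = C0).
        { apply (Hy x). unfold shift. replace (f [-] a [*] x [+] a [*] x) with f by vec.
          exact Hxf. }
        apply hinner_eq0 in H0. apply hinner_eqP. revert H0. ip_expand. lra. }
      apply hnorm_eq0. specialize (Hk' y hzero Hadj). rewrite hnorm_zero in Hk'.
      generalize (hnorm_ge0 y). lra. }
  split; [|split].
  - intro y. destruct (Hsurj (hopp y)) as [x Hx]. exists x, (hopp y [+] a [*] x).
    split; [exact Hx|]. vec.
  - intros x1 f1 x2 f2 H1 H2 E. apply hsub_eq0, hnorm_eq0.
    specialize (Hk (x1 [-] x2) hzero). rewrite hnorm_zero in Hk.
    assert (F : shift T a (x1 [-] x2) hzero).
    { unfold shift. replace (hzero [+] a [*] (x1 [-] x2)) with (f1 [-] f2).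
      - apply subspace_sub; assumption.
      - replace f1 with (a [*] x1 [-] (a [*] x1 [-] f1)) by vec. rewrite E. vec. }
    specialize (Hk F). generalize (hnorm_ge0 (x1 [-] x2)). lra.
  - exists k. intros x f Hxf. rewrite hnorm_sub_sym. apply Hk. unfold shift.
    replace (f [-] a [*] x [+] a [*] x) with f by vec. exact Hxf.
Qed.

Lemma resolvent_bounded_below T a : resolvent T a -> bounded_below (shift T a).
Proof.
  intros [_ [_ [k Hk]]]. exists k. intros x f Hx. specialize (Hk _ _ Hx).
  replace (a [*] x [-] (f [+] a [*] x)) with (hopp f) in Hk by vec.
  rewrite hnorm_opp in Hk. exact Hk.
Qed.

(** The pairing of [f + a x] with [x] is real by symmetry, so the imaginary part of the pairing of
    [f] with [x] is [- snd a * |x|^2]. Cauchy-Schwarz then bounds [|x|]. *)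
Lemma hermitian_nonreal_bounded_below T a :
  is_hermitian T -> snd a <> 0 -> bounded_below (shift T a).
Proof.
  intros HT Ha. exists (/ Rabs (snd a)). intros x f Hx.
  assert (Hs := HT _ _ Hx _ _ Hx). apply hinner_eqP in Hs. destruct Hs as [_ Hs].
  revert Hs. ip_expand. rewrite (im_sym f x). intro Hs.
  assert (E : im f x = - (snd a * re x x)) by lra.
  assert (Hle := cauchy_schwarz_abs_im f x). rewrite E, Rabs_Ropp, Rabs_mult in Hle.
  rewrite (Rabs_pos_eq (re x x)), <- hnorm_sq in Hle by apply re_diag_ge0.
  assert (Hpos := Rabs_pos_lt _ Ha).
  destruct (hnorm_ge0 x) as [Hx0|Hx0].
  - apply Rmult_le_reg_l with (Rabs (snd a)); [exact Hpos|].
    rewrite <- Rmult_assoc, Rinv_r, Rmult_1_l by lra.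
    apply Rmult_le_reg_r with (hnorm x); [exact Hx0|]. lra.
  - rewrite <- Hx0. apply Rmult_le_pos; [apply Rlt_le, Rinv_0_lt_compat, Hpos|apply hnorm_ge0].
Qed.

Lemma selfadjoint_hermitian T : is_selfadjoint T -> is_hermitian T.
Proof. intros HT x f. apply HT. Qed.

Lemma selfadjoint_nonreal_resolvent T a :
  is_subspace T -> is_selfadjoint T -> snd a <> 0 -> resolvent T a.
Proof.
  intros HS HT Ha. apply selfadjoint_resolvent; auto;
    apply hermitian_nonreal_bounded_below; auto using selfadjoint_hermitian.
  simpl. lra.
Qed.

Lemma selfadjoint_real_resolvent T (c : R) :
  is_subspace T -> is_selfadjoint T -> bounded_below (shift T (c, 0)) -> resolvent T (c, 0).
Proof.
  intros HS HT H. apply selfadjoint_resolvent; auto.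
  unfold Cconj. simpl. rewrite Ropp_0. exact H.
Qed.

(** * From spectral gaps to lower bounds *)

Lemma kernel_of_orthogonal_range T y :
  is_selfadjoint T -> (forall x f, T x f -> hinner y f = C0) -> T y hzero.
Proof.
  intros HT Hy. apply HT. intros x f Hx. rewrite (Hy x f Hx).
  apply hinner_eq0. ip_expand. auto.
Qed.

Lemma shift0 T x f : shift T (0, 0) x f <-> T x f.
Proof. unfold shift. replace (f [+] (0, 0) [*] x) with f by vec. reflexivity. Qed.

Lemma selfadjoint_surjective T :
  is_subspace T -> is_selfadjoint T -> bounded_below T -> forall y, exists x, T x y.
Proof.
  intros HS HT [k Hk]. apply bounded_below_surjective; auto using selfadjoint_conv_closed.
  - exists k. exact Hk.
  - intros y Hy. apply hnorm_eq0. assert (H := kernel_of_orthogonal_range T y HT Hy).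
    apply Hk in H. rewrite hnorm_zero in H. generalize (hnorm_ge0 y). lra.
Qed.

(* For [T x f], solve [T y x]. Since [<f, y> = |x|^2], the vector [f - s y] is short when
   [|f|^2] is close to [s |x|^2], while [x +- m y] is mapped by [T -+ m] to [f - s y]
   where [m^2 = s]. *)
Lemma lower_bound_improves T (s : R) :
  is_subspace T -> is_selfadjoint T -> bounded_below T -> 0 <= s ->
  bounded_below (shift T (sqrt s, 0)) -> bounded_below (shift T (- sqrt s, 0)) ->
  (forall x f, T x f -> s * re x x <= re f f) ->
  exists d, 0 < d /\ forall x f, T x f -> (s + d) * re x x <= re f f.
Proof.
  intros HS HT Hb Hs [k1 H1] [k2 H2] Hlow.
  set (m := sqrt s) in *. assert (Hm : m * m = s) by (apply sqrt_sqrt, Hs).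
  set (K := Rabs k1 + Rabs k2 + 1).
  assert (HK : 0 < K) by (unfold K; generalize (Rabs_pos k1) (Rabs_pos k2); lra).
  (* Adding the bounds for [x + m y] and [x - m y] gives [2 |x| <= K |u|], hence this increment. *)
  exists (4 / (K * K)). split; [apply Rdiv_lt_0_compat; nra|]. intros x f Hxf.
  destruct (selfadjoint_surjective T HS HT Hb x) as [y Hy].
  assert (Efy : re f y = re x x).
  { assert (E := proj1 (HT _ _) Hxf _ _ Hy). apply hinner_eqP in E. apply E. }
  assert (Hyx := Hlow _ _ Hy).
  set (u := f [-] (s, 0) [*] y).
  assert (Hu : re u u <= re f f - s * re x x).
  { unfold u. ip_expand. rewrite (re_sym f y), Efy. nra. }
  assert (HA : hnorm (x [+] (m, 0) [*] y) <= k1 * hnorm u).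
  { apply H1. unfold shift, u.
    replace (f [-] (s, 0) [*] y [+] (m, 0) [*] (x [+] (m, 0) [*] y))
      with (f [+] (m, 0) [*] x) by (rewrite <- Hm; vec).
    apply HS; [exact Hxf|]. apply HS, Hy. }
  assert (HB : hnorm (x [-] (m, 0) [*] y) <= k2 * hnorm u).
  { apply H2. unfold shift, u.
    replace (f [-] (s, 0) [*] y [+] (- m, 0) [*] (x [-] (m, 0) [*] y))
      with (f [-] (m, 0) [*] x) by (rewrite <- Hm; vec).
    apply subspace_sub; [exact HS|exact Hxf|]. apply HS, Hy. }
  assert (Hx2 : hnorm ((2, 0) [*] x) <= K * hnorm u).
  { replace ((2, 0) [*] x) with ((x [+] (m, 0) [*] y) [+] (x [-] (m, 0) [*] y)) by vec.
    generalize (hnorm_triangle (x [+] (m, 0) [*] y) (x [-] (m, 0) [*] y)) (hnorm_ge0 u)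
      (Rle_abs k1) (Rle_abs k2). unfold K. nra. }
  rewrite hnorm_rscal, Rabs_pos_eq in Hx2 by lra.
  assert (Hsq : 4 * re x x <= K * K * re u u).
  { rewrite <- !hnorm_sq. generalize (hnorm_ge0 x) (hnorm_ge0 u). nra. }
  assert (Hd : 4 / (K * K) * re x x <= re u u).
  { apply Rmult_le_reg_l with (K * K); [nra|].
    replace (K * K * (4 / (K * K) * re x x)) with (4 * re x x) by (field; lra). exact Hsq. }
  lra.
Qed.

(** The supremum [s] of the admissible constants up to [r^2] is itself admissible. If [s < r^2],
    both square roots of [s] lie in the interval, and [lower_bound_improves] contradicts
    maximality. *)
Lemma resolvent_interval_lower_bound T (r : R) :
  is_subspace T -> is_selfadjoint T -> 0 < r ->
  (forall c, Rabs c < r -> bounded_below (shift T (c, 0))) ->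
  forall x f, T x f -> r * r * re x x <= re f f.
Proof.
  intros HS HT Hr Hb.
  assert (Hb0 : bounded_below T).
  { destruct (Hb 0) as [k Hk]; [rewrite Rabs_R0; exact Hr|].
    exists k. intros x f H. apply Hk, shift0, H. }
  set (E := fun s => 0 <= s <= r * r /\ forall x f, T x f -> s * re x x <= re f f).
  destruct (completeness E) as [s [Hub Hlub]].
  - exists (r * r). intros s [Hs _]. lra.
  - exists 0. split; [nra|]. intros x f _. generalize (re_diag_ge0 f). lra.
  - assert (HEs : E s).
    { split; [split|].
      - apply Hub. split; [nra|]. intros x f _. generalize (re_diag_ge0 f). lra.
      - apply Hlub. intros t [Ht _]. lra.
      - intros x f Hxf. destruct (re_diag_ge0 x) as [Hx|Hx].
        + apply Rmult_le_reg_r with (/ re x x); [apply Rinv_0_lt_compat, Hx|].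
          rewrite Rmult_assoc, Rinv_r, Rmult_1_r by lra.
          apply Hlub. intros t [_ Ht]. specialize (Ht _ _ Hxf).
          apply Rmult_le_reg_r with (re x x); [exact Hx|].
          rewrite Rmult_assoc, Rinv_l by lra. lra.
        + rewrite <- Hx. generalize (re_diag_ge0 f). lra. }
    destruct HEs as [[Hs0 [Hs|Hs]] HEs]; [exfalso|rewrite <- Hs; exact HEs].
    assert (Hsr : sqrt s < r).
    { apply sq_lt_reg; [lra|]. rewrite sqrt_sqrt; lra. }
    assert (Hsp := sqrt_pos s).
    destruct (lower_bound_improves T s) as [d [Hd Himp]]; auto.
    + apply Hb. rewrite Rabs_pos_eq; lra.
    + apply Hb. rewrite Rabs_Ropp, Rabs_pos_eq; lra.
    (* The increment is truncated to keep the constant at most [r^2]. *)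
    + assert (Hmin : 0 < Rmin d (r * r - s)) by (apply Rmin_pos; lra).
      assert (s + Rmin d (r * r - s) <= s); [|lra].
      apply Hub. split.
      * generalize (Rmin_r d (r * r - s)). lra.
      * intros x f Hxf. specialize (Himp _ _ Hxf).
        generalize (Rmin_l d (r * r - s)) (re_diag_ge0 x). nra.
Qed.

(** If [p] is the projection of [x] on the closed range, [x - p] is in the kernel. Both [x] and [p]
    are orthogonal to it, so it vanishes. *)
Lemma closure_range_of_orthogonal_kernel T x :
  is_subspace T -> is_selfadjoint T -> (forall p, T p hzero -> hinner x p = C0) ->
  exists y g : nat -> X, (forall n, T (y n) (g n)) /\ hconv g x.
Proof.
  intros HS HT Hx.
  destruct (projection_closure (fun f => exists y, T y f) x) as [p [g [Hg [Hp Horth]]]].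
  { apply range_vsubspace, HS. }
  assert (Hker : T (x [-] p) hzero).
  { apply kernel_of_orthogonal_range; [exact HT|]. intros y f Hy. apply Horth. exists y. exact Hy. }
  assert (E : x = p).
  { apply hsub_eq0, re_diag_eq0.
    assert (E1 : re x (x [-] p) = 0) by apply hinner_eq0, Hx, Hker.
    assert (E2 : re p (x [-] p) = 0).
    { apply (hconv_re_const g p _ 0 Hp). intro n. rewrite re_sym.
      apply hinner_eq0, Horth, Hg. }
    rewrite re_sub_l. lra. }
  apply choice_fun in Hg. destruct Hg as [y Hy]. exists y, g. rewrite E. auto.
Qed.

(* The two half-gaps give [eps |<f, x>| <= |f|^2], i.e. the inverse of [T] has bounded
   numerical range, hence is bounded by polarization. *)
Lemma punctured_gap_lower_bound T (eps : R) :
  is_subspace T -> is_selfadjoint T -> 0 < eps ->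
  (forall c, 0 < Rabs c < eps -> bounded_below (shift T (c, 0))) ->
  forall x f, T x f -> (forall p, T p hzero -> hinner x p = C0) -> eps * hnorm x <= hnorm f.
Proof.
  intros HS HT He Hb.
  (* The interval of radius [eps / 2] around [e] avoids 0 and stays within the gap. There
     [|f - e x|^2 >= e^2 |x|^2], and expanding the square leaves the claim. *)
  assert (Hhalf : forall e, Rabs e = eps / 2 ->
            forall x f, T x f -> 2 * e * re f x <= re f f).
  { intros e Ee x f Hxf.
    assert (H := resolvent_interval_lower_bound (shift T (e, 0)) (eps / 2)
      (shift_subspace _ _ HS) (shift_selfadjoint _ _ HT) ltac:(lra)).
    assert (Hee : e * e = eps / 2 * (eps / 2)).
    { rewrite <- Ee. exact (Rsqr_abs e). }
    specialize (H ltac:(intros c Hc; apply bounded_below_shift_shift, Hb;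
      generalize (Rabs_triang e c) (Rabs_triang (e + c) (- c));
      rewrite Rabs_Ropp; replace (e + c + - c) with e by ring; lra)).
    specialize (H x (f [-] (e, 0) [*] x)).
    assert (F : shift T (e, 0) x (f [-] (e, 0) [*] x)).
    { unfold shift. replace (f [-] (e, 0) [*] x [+] (e, 0) [*] x) with f by vec. exact Hxf. }
    specialize (H F). revert H. rewrite <- Hee. ip_expand. rewrite (re_sym f x). nra. }
  (* The inequality at [eps / 2] for the sum is added to the one at [- eps / 2] for the
     difference. *)
  assert (Hpol : forall x f y g, T x f -> T y g -> 2 * eps * re x g <= re f f + re g g).
  { intros x f y g Hx Hy.
    assert (H1 := Hhalf (eps / 2) ltac:(apply Rabs_pos_eq; lra) (x [+] y) (f [+] g)
      ltac:(apply HS; assumption)).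
    assert (H2 := Hhalf (- (eps / 2)) ltac:(rewrite Rabs_Ropp; apply Rabs_pos_eq; lra)
      (x [-] y) (f [-] g) ltac:(apply subspace_sub; assumption)).
    assert (E := proj1 (HT _ _) Hx _ _ Hy). apply hinner_eqP in E. destruct E as [E _].
    revert H1 H2. ip_expand. rewrite (re_sym f g), (re_sym x g), E. nra. }
  intros x f Hxf Hker.
  destruct (closure_range_of_orthogonal_kernel T x HS HT Hker) as [y [g [Hy Hg]]].
  (* Ideally [g] would be [eps x], but [x] is only in the closure of the range; the approximants
     [eps g n] are used and the limit is taken. *)
  assert (Hlim : 2 * eps * (eps * re x x) <= re f f + eps * eps * (hnorm x * hnorm x)).
  { apply Rle_cv_lim with (Un := fun n => 2 * eps * (eps * re (g n) x))
      (Vn := fun n => re f f + eps * eps * (hnorm (g n) * hnorm (g n))).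
    - intro n. assert (H := Hpol x f ((eps, 0) [*] y n) ((eps, 0) [*] g n) Hxf
        ltac:(apply HS, Hy)).
      rewrite hnorm_sq. revert H. ip_expand. rewrite (re_sym (g n) x). lra.
    - apply (CV_mult (fun _ => 2 * eps) (fun n => eps * re (g n) x)); [apply Un_cv_const|].
      apply (CV_mult (fun _ => eps) (fun n => re (g n) x)); [apply Un_cv_const|].
      apply hconv_re, Hg.
    - apply (CV_plus (fun _ => re f f) (fun n => eps * eps * (hnorm (g n) * hnorm (g n))));
        [apply Un_cv_const|].
      apply (CV_mult (fun _ => eps * eps) (fun n => hnorm (g n) * hnorm (g n)));
        [apply Un_cv_const|].
      apply CV_mult; apply hconv_norm, Hg. }
  apply sq_le_reg; [apply hnorm_ge0|]. rewrite <- !hnorm_sq in Hlim. lra.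
Qed.

(** * Properness, kernels and isolated points *)

Lemma kernel_decomposition T x f :
  is_subspace T -> conv_closed T -> T x f ->
  exists p y, T p hzero /\ T y f /\ x = p [+] y /\ forall q, T q hzero -> hinner y q = C0.
Proof.
  intros HS HC Hxf.
  destruct (projection_closure (fun p => T p hzero) x) as [p [w [Hw [Hp Horth]]]].
  { apply kernel_vsubspace, HS. }
  assert (Tp : T p hzero).
  { apply (HC w (fun _ => hzero)); auto. intros eps He. exists O. intros.
    replace (hzero [-] hzero) with (hzero : X) by vec. rewrite hnorm_zero. exact He. }
  exists p, (x [-] p). split; [exact Tp|]. split; [|split; [vec|exact Horth]].
  replace f with (f [-] hzero) by vec. apply subspace_sub; assumption.
Qed.

(** Otherwise unit vectors orthogonal to the kernel have images tending to 0. Properness gives a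
    limit point in the kernel, of norm 1 and orthogonal to itself. *)
Lemma proper_gap T :
  is_subspace T -> conv_closed T -> proper T ->
  exists c, 0 < c /\ forall x f, T x f -> (forall q, T q hzero -> hinner x q = C0) ->
    c * hnorm x <= hnorm f.
Proof.
  intros HS HC Hprop. apply NNPP. intro Hno.
  assert (Hn : forall n : nat, exists xf : X * X, T (fst xf) (snd xf) /\
     (forall q, T q hzero -> hinner (fst xf) q = C0) /\ hnorm (fst xf) = 1 /\
     hnorm (snd xf) <= / INR (S n)).
  { intro n. apply NNPP. intro Hn. apply Hno. exists (/ INR (S n)).
    split; [apply INR_S_inv_pos|]. intros x f Hxf Horth. apply Rnot_lt_le. intro Hlt.
    apply Hn. clear Hno Hn.
    assert (Hx : x <> hzero).
    { intros ->. rewrite hnorm_zero in Hlt. generalize (hnorm_ge0 f). lra. }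
    assert (Hpos : 0 < hnorm x).
    { destruct (hnorm_ge0 x) as [H|H]; [exact H|]. exfalso. apply Hx, hnorm_eq0. auto. }
    exists ((/ hnorm x, 0) [*] x, (/ hnorm x, 0) [*] f). cbn [fst snd]. split; [|split; [|split]].
    - apply HS, Hxf.
    - intros q Hq. specialize (Horth q Hq). apply hinner_eq0 in Horth.
      apply hinner_eq0. ip_expand. destruct Horth as [-> ->]. lra.
    - apply normalize_unit, Hx.
    - rewrite hnorm_rscal, Rabs_pos_eq by (apply Rlt_le, Rinv_0_lt_compat, Hpos).
      apply Rmult_le_reg_l with (hnorm x); [exact Hpos|].
      rewrite <- Rmult_assoc, Rinv_r, Rmult_1_l by lra.
      lra. }
  apply choice_fun in Hn. destruct Hn as [xf Hxf].
  assert (Hf : hconv (fun n => snd (xf n)) hzero).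
  { apply hconv_of_bound. intro n. replace (snd (xf n) [-] hzero) with (snd (xf n)) by vec.
    apply Hxf. }
  destruct (Hprop (fun n => fst (xf n)) (fun n => snd (xf n)) 1) as [phi [Hphi Hc]].
  - intro n. apply Hxf.
  - intro n. right. apply Hxf.
  - apply (hconv_cauchy _ hzero Hf).
  - destruct (hcauchy_conv _ Hc) as [l Hl].
    assert (Tl : T l hzero).
    { apply (HC (fun n => fst (xf (phi n))) (fun n => snd (xf (phi n)))).
      - intro n. apply Hxf.
      - exact Hl.
      - apply (hconv_subseq (fun n => snd (xf n))); assumption. }
    assert (E0 : re l l = 0).
    { apply (hconv_re_const _ l l 0 Hl). intro n. apply hinner_eq0, Hxf, Tl. }
    assert (E1 : hnorm l = 1).
    { apply (UL_sequence (fun n => hnorm (fst (xf (phi n))))).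
      - apply (hconv_norm (fun n => fst (xf (phi n))) l Hl).
      - intros eps He. exists O. intros n _. destruct (Hxf (phi n)) as [_ [_ [-> _]]].
        unfold Rdist. rewrite Rminus_diag, Rabs_R0. exact He. }
    rewrite <- hnorm_sq, E1 in E0. lra.
Qed.

(** Split [x = p + y] along the kernel. Then [T - c] acts as [- c] on [p], and is bounded below by
    [d - |c|] on [y]. The two images are orthogonal because the range is orthogonal to the kernel,
    so each is bounded by [|g|]. *)
Lemma proper_punctured_resolvent T :
  is_subspace T -> is_selfadjoint T -> proper T ->
  exists eps, 0 < eps /\ forall c, 0 < Rabs c < eps -> bounded_below (shift T (c, 0)).
Proof.
  intros HS HT Hprop. assert (HC := selfadjoint_conv_closed T HT).
  destruct (proper_gap T HS HC Hprop) as [d [Hd Hgap]].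
  exists d. split; [exact Hd|]. intros c [Hc0 Hcd].
  exists (/ (d - Rabs c) + / Rabs c). intros x g Hx. unfold shift in Hx.
  destruct (kernel_decomposition T _ _ HS HC Hx) as [p [y [Tp [Ty [E Horth]]]]].
  set (f := g [+] (c, 0) [*] x) in *.
  assert (Hfp : re f p = 0).
  { assert (F := proj1 (HT _ _) Ty _ _ Tp). apply hinner_eqP in F. destruct F as [F _].
    rewrite F. apply re_zero_r. }
  assert (Hyp : re y p = 0) by apply hinner_eq0, Horth, Tp.
  assert (Eg : g = (f [-] (c, 0) [*] y) [-] (c, 0) [*] p).
  { unfold f. rewrite E. vec. }
  assert (Hsq : re g g = re (f [-] (c, 0) [*] y) (f [-] (c, 0) [*] y) + c * c * re p p).
  { rewrite Eg. ip_expand. rewrite (re_sym f p), (re_sym y p), Hfp, Hyp. ring. }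
  assert (Hcc : Rabs c * Rabs c = c * c) by exact (eq_sym (Rsqr_abs c)).
  assert (Hp : Rabs c * hnorm p <= hnorm g).
  { apply sq_le_reg; [apply hnorm_ge0|]. rewrite hnorm_sq, Hsq.
    replace (Rabs c * hnorm p * (Rabs c * hnorm p))
      with (Rabs c * Rabs c * (hnorm p * hnorm p)) by ring.
    rewrite Hcc, hnorm_sq. generalize (re_diag_ge0 (f [-] (c, 0) [*] y)). lra. }
  assert (Hy : (d - Rabs c) * hnorm y <= hnorm g).
  { apply Rle_trans with (hnorm (f [-] (c, 0) [*] y)).
    - assert (H1 := Hgap _ _ Ty Horth). assert (H2 := hnorm_dist_rev f ((c, 0) [*] y)).
      rewrite hnorm_rscal in H2. lra.
    - apply sq_le_reg; [apply hnorm_ge0|]. rewrite !hnorm_sq, Hsq.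
      generalize (re_diag_ge0 p). nra. }
  rewrite E. apply Rle_trans with (1 := hnorm_triangle _ _).
  rewrite Rmult_plus_distr_r, Rplus_comm.
  apply Rplus_le_compat.
  - apply Rmult_le_reg_l with (d - Rabs c); [lra|].
    rewrite <- Rmult_assoc, Rinv_r, Rmult_1_l by lra. exact Hy.
  - apply Rmult_le_reg_l with (Rabs c); [lra|].
    rewrite <- Rmult_assoc, Rinv_r, Rmult_1_l by lra. exact Hp.
Qed.

(** The gap makes the components orthogonal to the kernel Cauchy; the bounded kernel components have
    a Cauchy subsequence by finite dimension. *)
Lemma gap_fin_dim_kernel_proper T (c : R) :
  is_subspace T -> conv_closed T -> 0 < c ->
  (forall x f, T x f -> (forall q, T q hzero -> hinner x q = C0) -> c * hnorm x <= hnorm f) ->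
  ~ inf_dim (fun x => T x hzero) -> proper T.
Proof.
  intros HS HC Hc Hgap Hfin x f M Hxf HM Hf.
  apply not_all_ex_not in Hfin. destruct Hfin as [d Hfin].
  assert (Hdec := fun n => kernel_decomposition T _ _ HS HC (Hxf n)).
  apply choice_fun in Hdec. destruct Hdec as [p Hdec].
  apply choice_fun in Hdec. destruct Hdec as [y Hdec].
  assert (Hy : hcauchy y).
  { apply (hcauchy_dominated y f (/ c)); [|exact Hf]. intros n m.
    apply Rmult_le_reg_l with c; [exact Hc|]. rewrite <- Rmult_assoc, Rinv_r, Rmult_1_l by lra.
    destruct (Hdec n) as [_ [T1 [_ O1]]], (Hdec m) as [_ [T2 [_ O2]]].
    apply Hgap; [apply subspace_sub; assumption|]. intros q Hq.
    specialize (O1 q Hq). specialize (O2 q Hq). apply hinner_eq0 in O1, O2.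
    apply hinner_eq0. ip_expand. lra. }
  destruct (hcauchy_bounded y Hy) as [My HMy].
  destruct (fin_dim_subseq_cauchy d _ (kernel_vsubspace T HS) Hfin p (M + My)) as [phi [Hphi Hpc]].
  - intro n. apply Hdec.
  - intro n. destruct (Hdec n) as [_ [_ [E _]]].
    replace (p n) with (x n [-] y n) by (rewrite E; vec).
    generalize (hnorm_triangle_sub (x n) (y n)) (HM n) (HMy n). lra.
  - exists phi. split; [exact Hphi|].
    assert (H := hcauchy_add _ _ Hpc (hcauchy_subseq y phi Hphi Hy)).
    intros eps He. destruct (H eps He) as [N HN]. exists N. intros n m Hn Hm.
    specialize (HN n m Hn Hm).
    destruct (Hdec (phi n)) as [_ [_ [-> _]]], (Hdec (phi m)) as [_ [_ [-> _]]]. exact HN.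
Qed.

Lemma proper_kernel_fin_dim T :
  is_subspace T -> proper T -> ~ inf_dim (fun x => T x hzero).
Proof.
  intros HS Hprop Hinf.
  destruct (inf_dim_no_cauchy _ (kernel_vsubspace T HS) Hinf) as [e [He [Hn Hno]]].
  destruct (Hprop e (fun _ => hzero) 1) as [phi [Hphi Hc]].
  - exact He.
  - intro n. rewrite Hn. lra.
  - intros eps Heps. exists O. intros. replace (hzero [-] hzero) with (hzero : X) by vec.
    rewrite hnorm_zero. exact Heps.
  - exact (Hno phi Hphi Hc).
Qed.

(** * The essential spectrum in terms of properness *)

Lemma shift_kernel T a x : shift T a x hzero <-> T x (a [*] x).
Proof. unfold shift. rewrite hadd_zero. reflexivity. Qed.

Lemma inf_dim_mono (V W : X -> Prop) : (forall x, V x -> W x) -> inf_dim V -> inf_dim W.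
Proof.
  intros H HV n. destruct (HV n) as [v [Hv Hi]]. exists v. split; auto.
Qed.

Lemma Cmod_real (a b : R) : Cmod (Csub (a + b, 0) (a, 0)) = Rabs b.
Proof.
  unfold Cmod. simpl.
  replace ((a + b + - a) * (a + b + - a) + (0 + - 0) * (0 + - 0)) with (Rsqr b)
    by (unfold Rsqr; ring).
  apply sqrt_Rsqr_abs.
Qed.

Lemma ess_spectrum_iff_not_proper T (lam : R) :
  is_subspace T -> is_selfadjoint T ->
  ess_spectrum T (lam, 0) <-> ~ proper (shift T (lam, 0)).
Proof.
  intros HS HT.
  assert (HSl := shift_subspace T (lam, 0) HS). assert (HTl := shift_selfadjoint T lam HT).
  assert (HW := kernel_vsubspace _ HSl).
  split.
  - intros [_ Hess] Hprop. destruct Hess as [Hacc|[_ [_ Hinf]]].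
    + destruct (proper_punctured_resolvent _ HSl HTl Hprop) as [eps [He Hb]].
      destruct (Hacc eps He) as [[m1 m2] [Hsp [Hne Hlt]]]. apply Hsp.
      destruct (Req_dec m2 0) as [->|Hm2]; [|apply selfadjoint_nonreal_resolvent; auto].
      apply selfadjoint_real_resolvent; auto.
      replace m1 with (lam + (m1 - lam)) in * by ring.
      rewrite Cmod_real in Hlt.
      destruct (Hb (m1 - lam)) as [k Hk].
      * split; [|exact Hlt]. apply Rabs_pos_lt. intro E. apply Hne. f_equal. lra.
      * exists k. intros x f Hx. apply Hk, shift_shift, Hx.
    + apply (proper_kernel_fin_dim _ HSl Hprop). revert Hinf. apply inf_dim_mono.
      intros x. apply shift_kernel.
  - intro Hnp. apply NNPP. intro Hness. apply Hnp. clear Hnp.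
    assert (Hcl := selfadjoint_conv_closed _ HTl).
    (* Outside the essential spectrum, [lam] is either in the resolvent set, where [T - lam] is
       bounded below, or an isolated point of the spectrum. *)
    destruct (classic (resolvent T (lam, 0))) as [Hres|Hsp].
    { apply resolvent_bounded_below in Hres. destruct Hres as [k Hk].
      intros x f M Hxf _ Hf. exists (fun n => n). split; [intro n; lia|].
      apply (hcauchy_dominated x f k); [|exact Hf].
      intros n m. apply Hk, subspace_sub; auto. }
    assert (Hnacc : ~ accumulation_point (spectrum T) (lam, 0)).
    { intro Hacc. apply Hness. split; [exact Hsp|]. left. exact Hacc. }
    assert (Hiso : exists eps, 0 < eps /\
      forall c, 0 < Rabs c < eps -> bounded_below (shift (shift T (lam, 0)) (c, 0))).
    { apply not_all_ex_not in Hnacc. destruct Hnacc as [eps Heps].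
      apply imply_to_and in Heps. destruct Heps as [He Hno].
      exists eps. split; [exact He|]. intros c [Hc0 Hc].
      apply bounded_below_shift_shift, resolvent_bounded_below.
      apply NNPP. intro Hs. apply Hno. exists (lam + c, 0). split; [exact Hs|]. split.
      - intro E. injection E. intro E'. assert (c = 0) by lra. subst c.
        rewrite Rabs_R0 in Hc0. lra.
      - rewrite Cmod_real. exact Hc. }
    destruct Hiso as [eps [He Hb]].
    apply (gap_fin_dim_kernel_proper _ eps); auto.
    + apply punctured_gap_lower_bound; auto.
    (* An infinite-dimensional kernel would make [lam] an isolated eigenvalue of infinite
       multiplicity. *)
    + intro Hinf. apply Hness. split; [exact Hsp|]. right. split; [exact Hnacc|].
      assert (HinfT : infinite_multiplicity T (lam, 0)).
      { revert Hinf. apply inf_dim_mono. intros x. apply shift_kernel. }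
      split; [|exact HinfT].
      destruct (inf_dim_unit_orthogonal nil _ HW Hinf) as [e [Te [Hn _]]].
      exists e. split; [|exact (proj1 (shift_kernel _ _ _) Te)].
      intros ->. rewrite hnorm_zero in Hn. lra.
Qed.

Lemma selfadjoint_ess_spectrum_real T a :
  is_subspace T -> is_selfadjoint T -> ess_spectrum T a -> snd a = 0.
Proof.
  intros HS HT [Hsp _]. apply NNPP. intro Ha. apply Hsp.
  apply selfadjoint_nonreal_resolvent; assumption.
Qed.

End Relations.

(** * Relatively compact perturbations *)

Section Perturbation.
Context {X : CHilbert}.
Implicit Types x y z f g h p s b : X.
Implicit Types T A : @rel X.

(** For [(y, g)] in the adjoint, surjectivity of [T - a] gives [x] in the domain for which [y - x]
    is orthogonal to the range of [T - Cconj a]. That range is everything, so [y = x]. *)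
Lemma selfadjoint_of_surjective T a :
  is_subspace T -> is_hermitian T ->
  (forall y, exists x, shift T a x y) -> (forall y, exists x, shift T (Cconj a) x y) ->
  is_selfadjoint T.
Proof.
  intros HS HR H1 H2 y g. split; [apply HR|]. intro Hyg.
  destruct (H1 (g [-] a [*] y)) as [x Hx]. unfold shift in Hx.
  destruct (H2 (y [-] x)) as [u Hu]. unfold shift in Hu.
  assert (E1 := Hyg _ _ Hu). assert (E2 := HR _ _ Hx _ _ Hu).
  assert (Ez : y = x).
  { apply hsub_eq0, re_diag_eq0. apply hinner_eqP in E1, E2.
    destruct E1 as [E1 _], E2 as [E2 _]. revert E1 E2. ip_expand. lra. }
  subst x. replace g with (g [-] a [*] y [+] a [*] y) by vec. exact Hx.
Qed.

(** * Operator parts and projections *)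

Lemma T_s_iff T x s : T_s T x s <-> T x s /\ perp0 T s.
Proof.
  assert (E : forall g, inner2 x s hzero g = hinner s g).
  { intro g. apply Cpair_eq; unfold inner2; cbn [fst snd Cadd].
    - fold (re x hzero). rewrite re_zero_r. ring.
    - fold (im x hzero). rewrite im_zero_r. ring. }
  split; intros [Hx Hp]; (split; [exact Hx|]).
  - intros g Hg. rewrite <- E. apply Hp. split; auto.
  - intros y g [-> Hg]. rewrite E. apply Hp, Hg.
Qed.

Lemma perp0_vsubspace T : is_vsubspace (perp0 T).
Proof.
  split; [|split].
  - intros g _. apply hinner_eq0. ip_expand. auto.
  - intros x y Hx Hy g Hg. specialize (Hx g Hg). specialize (Hy g Hg).
    apply hinner_eq0 in Hx, Hy. apply hinner_eq0. ip_expand. lra.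
  - intros a x Hx g Hg. specialize (Hx g Hg). apply hinner_eq0 in Hx.
    apply hinner_eq0. ip_expand. destruct Hx as [-> ->]. lra.
Qed.

Lemma multivalued_vsubspace T : is_subspace T -> is_vsubspace (fun g => T hzero g).
Proof.
  intros [H0 [HD HZ]]. split; [|split].
  - exact H0.
  - intros f g Hf Hg. rewrite <- (hadd_zero X hzero). auto.
  - intros a f Hf. replace (hzero : X) with (a [*] hzero : X) by vec. auto.
Qed.

Lemma hermitian_dom_perp0 T x f : is_hermitian T -> T x f -> perp0 T x.
Proof.
  intros HT Hx g Hg. rewrite <- (HT _ _ Hx _ _ Hg). apply hinner_eq0. ip_expand. auto.
Qed.

(** By Pythagoras. Applied to differences, it keeps a sequence Cauchy when its terms are replaced by
    their components orthogonal to [T(0)]. *)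
Lemma perp0_norm_le T u v : perp0 T u -> T hzero (v [-] u) -> hnorm u <= hnorm v.
Proof.
  intros Hu Hv. apply sq_le_reg; [apply hnorm_ge0|]. rewrite !hnorm_sq.
  assert (E := Hu _ Hv). apply hinner_eq0 in E. destruct E as [E _].
  replace v with (u [+] (v [-] u)) by vec. rewrite re_add_l, !re_add_r, (re_sym u (v [-] u)), E.
  generalize (re_diag_ge0 (v [-] u)). lra.
Qed.

Lemma operator_part_exists T x f :
  is_subspace T -> conv_closed T -> T x f -> exists s, T_s T x s.
Proof.
  intros HS HC Hx.
  destruct (projection_closure (fun g => T hzero g) f (multivalued_vsubspace T HS))
    as [p [w [Hw [Hp Horth]]]].
  assert (Tp : T hzero p).
  { apply (HC (fun _ => hzero) w); auto. intros eps He. exists O. intros.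
    replace (hzero [-] hzero) with (hzero : X) by vec. rewrite hnorm_zero. exact He. }
  exists (f [-] p). apply T_s_iff. split; [|exact Horth].
  replace x with (x [-] hzero) by vec. apply subspace_sub; assumption.
Qed.

Lemma T_s_scal T a x s : is_subspace T -> T_s T x s -> T_s T (a [*] x) (a [*] s).
Proof.
  intros HS. rewrite !T_s_iff. intros [Hx Hs].
  split; [apply HS, Hx|apply perp0_vsubspace, Hs].
Qed.

Lemma proj_comp_scal T A a x b :
  is_subspace A -> proj_comp T A x b -> proj_comp T A (a [*] x) (a [*] b).
Proof.
  intros HA [f [Hf [Hb Horth]]]. exists (a [*] f). split; [apply T_s_scal; assumption|].
  split; [apply perp0_vsubspace, Hb|]. intros z Hz. specialize (Horth z Hz).
  apply hinner_eq0 in Horth. apply hinner_eq0. revert Horth. ip_expand. intros [E1 E2].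
  assert (F1 : re f z = re b z) by lra. assert (F2 : im f z = im b z) by lra.
  rewrite F1, F2. lra.
Qed.

Section Fixed.
Context (T A : @rel X).
Context (HS : is_subspace T) (HT : is_selfadjoint T).
Context (HA : is_subspace A) (HAh : is_hermitian A).
Context (Hdom : forall x, dom T x -> dom A x).
Context (Hcomp : rel_compact_wrt (proj_comp T A) (T_s T)).

(** The multivalued part of an adjoint is the orthogonal complement of the domain, and [T] is its
    own adjoint. *)
Lemma orthogonal_dom_multivalued g : (forall x f, T x f -> hinner g x = C0) -> T hzero g.
Proof.
  intro H. apply HT. intros x f Hx. rewrite (H x f Hx).
  symmetry. apply hinner_eq0. ip_expand. auto.
Qed.

Lemma perturbation_multivalued g : A hzero g -> T hzero g.
Proof.
  intro Hg. apply orthogonal_dom_multivalued. intros x f Hx.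
  destruct (Hdom x (ex_intro _ f Hx)) as [a Ha].
  rewrite (HAh _ _ Hg _ _ Ha). apply hinner_eq0. ip_expand. auto.
Qed.

(** The projection error [a - b] is orthogonal to the complement of [T(0)], which contains [D(T)];
    hence it lies in [T(0)]. *)
Lemma proj_compE x b : proj_comp T A x b -> perp0 T b /\ exists a, A x a /\ T hzero (a [-] b).
Proof.
  intros [a [Ha [Hb Horth]]]. split; [exact Hb|]. exists a. split; [apply Ha|].
  apply orthogonal_dom_multivalued. intros y f Hy. apply Horth.
  apply (hermitian_dom_perp0 T y f); auto using selfadjoint_hermitian.
Qed.

Lemma parts_exist x f : T x f -> exists s b, T_s T x s /\ proj_comp T A x b.
Proof.
  intro Hx.
  destruct (operator_part_exists T x f HS (selfadjoint_conv_closed T HT) Hx) as [s Hs].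
  destruct Hcomp as [Hd _]. destruct (Hd x (ex_intro _ s Hs)) as [b Hb]. eauto.
Qed.

(** The error [a - b] is in [T(0)] and can be absorbed into the summand from [T]. *)
Lemma rel_sum_proj_comp x f b : T x f -> proj_comp T A x b -> rel_sum T A x (f [+] b).
Proof.
  intros Hx Hb. destruct (proj_compE x b Hb) as [_ [a [Ha Hab]]].
  exists (f [-] (a [-] b)), a. split; [|split; [exact Ha|vec]].
  replace x with (x [-] hzero) by vec. apply subspace_sub; assumption.
Qed.

Lemma rel_sum_parts x h s b :
  rel_sum T A x h -> T_s T x s -> proj_comp T A x b -> T hzero (h [-] (s [+] b)).
Proof.
  intros [f [g [Hf [Hg ->]]]] Hs Hb. apply T_s_iff in Hs. destruct Hs as [Hs _].
  destruct (proj_compE x b Hb) as [_ [a [Ha Hab]]].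
  assert (M := multivalued_vsubspace T HS).
  replace (f [+] g [-] (s [+] b)) with ((f [-] s) [+] ((g [-] a) [+] (a [-] b))) by vec.
  assert (E : hzero = x [-] x) by vec.
  apply M; [|apply M; [apply perturbation_multivalued|exact Hab]];
    rewrite E; apply subspace_sub; assumption.
Qed.

(** Symmetry of [A] survives the projection: the discarded part is in [T(0)], orthogonal to [y]. *)
Lemma proj_comp_symmetric x b y f a :
  proj_comp T A x b -> T y f -> A y a -> hinner b y = hinner x a.
Proof.
  intros Hb Hy Ha. destruct (proj_compE x b Hb) as [_ [a' [Ha' Hab]]].
  assert (E1 := HAh _ _ Ha' _ _ Ha).
  assert (E2 := hermitian_dom_perp0 T y f (selfadjoint_hermitian T HT) Hy _ Hab).
  apply hinner_eq0 in E2. apply hinner_eqP in E1. apply hinner_eqP. revert E1 E2. ip_expand.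
  rewrite (re_sym y b), (re_sym y a'), (im_sym y b), (im_sym y a'). lra.
Qed.

(* Otherwise there are [x_n -> 0] with [T_s x_n] bounded and [|Q A_s x_n| = 1]. A limit
   point [l] of [Q A_s x_n] is orthogonal to [D(T)] by symmetry, hence lies in [T(0)],
   but it also lies in the orthogonal complement of [T(0)]. *)
Lemma proj_comp_relative_bound :
  exists c, 0 <= c /\ forall x s b, T_s T x s -> proj_comp T A x b ->
    hnorm b <= / 2 * hnorm s + c * hnorm x.
Proof.
  apply NNPP. intro Hno.
  assert (Hn : forall n : nat, exists q : X * X * X,
    T_s T (fst (fst q)) (snd (fst q)) /\ proj_comp T A (fst (fst q)) (snd q) /\
    hnorm (snd q) = 1 /\ hnorm (snd (fst q)) <= 2 /\ hnorm (fst (fst q)) <= / INR (S n)).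
  (* A counterexample to the constant [INR (S n)], scaled to [|b| = 1], has
     [|s| / 2 + INR (S n) |x| < 1], which bounds both terms. *)
  { intro n. apply NNPP. intro Hn. apply Hno. exists (INR (S n)).
    assert (Hpos : 0 < INR (S n)) by (apply lt_0_INR; lia).
    split; [lra|]. intros x s b Hs Hb. apply Rnot_lt_le. intro Hlt. apply Hn.
    assert (Px := hnorm_ge0 x). assert (Ps := hnorm_ge0 s).
    assert (Pxn : 0 <= INR (S n) * hnorm x) by (apply Rmult_le_pos; lra).
    assert (Pb : 0 < hnorm b) by lra.
    assert (Pi := Rinv_0_lt_compat _ Pb).
    exists ((/ hnorm b, 0) [*] x, (/ hnorm b, 0) [*] s, (/ hnorm b, 0) [*] b).
    cbn [fst snd]. rewrite !hnorm_rscal, !Rabs_pos_eq by lra.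
    split; [apply T_s_scal; assumption|]. split; [apply proj_comp_scal; assumption|].
    split; [apply Rinv_l; lra|]. split.
    - apply Rmult_le_reg_l with (hnorm b); [exact Pb|].
      rewrite <- Rmult_assoc, Rinv_r, Rmult_1_l by lra. lra.
    - apply Rmult_le_reg_l with (hnorm b); [exact Pb|].
      rewrite <- Rmult_assoc, Rinv_r, Rmult_1_l by lra.
      apply Rmult_le_reg_r with (INR (S n)); [exact Hpos|].
      rewrite Rmult_assoc, Rinv_l by lra. lra. }
  apply choice_fun in Hn. destruct Hn as [q Hq].
  set (x := fun n => fst (fst (q n))). set (s := fun n => snd (fst (q n))).
  set (b := fun n => snd (q n)).
  destruct Hcomp as [_ Hc].
  destruct (Hc x s b 3) as [phi [l [Hphi Hl]]].
  - intro n. apply Hq.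
  - intro n. apply Hq.
  - intro n. destruct (Hq n) as [_ [_ [_ [H1 H2]]]]. fold (x n) in H2. fold (s n) in H1.
    assert (/ INR (S n) <= 1); [|lra]. rewrite <- Rinv_1. apply Rinv_le_contravar; [lra|].
    rewrite S_INR. generalize (pos_INR n). lra.
  - assert (Hx : hconv (fun n => x (phi n)) hzero).
    { apply (hconv_subseq x); [exact Hphi|]. apply hconv_of_bound. intro n.
      replace (x n [-] hzero) with (x n) by vec. apply Hq. }
    assert (Hre : forall y f, T y f -> re l y = 0).
    { intros y f Hy. destruct (Hdom y (ex_intro _ f Hy)) as [a Ha].
      rewrite <- (re_zero_l a). apply (UL_sequence (fun n => re (b (phi n)) y)).
      - apply (hconv_re (fun n => b (phi n))), Hl.
      - intros eps He. destruct (hconv_re _ _ a Hx eps He) as [N HN]. exists N.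
        intros n Hn. specialize (HN n Hn).
        assert (E : hinner (b (phi n)) y = hinner (x (phi n)) a).
        { apply (proj_comp_symmetric _ _ _ f); auto. apply Hq. }
        apply hinner_eqP in E. destruct E as [-> _]. exact HN. }
    assert (Tl : T hzero l).
    { apply orthogonal_dom_multivalued. intros y f Hy. apply hinner_eq0.
      split; [apply (Hre y f Hy)|].
      assert (E := Hre ((0, 1) [*] y) ((0, 1) [*] f) ltac:(apply HS, Hy)).
      revert E. ip_expand. lra. }
    assert (E0 : re l l = 0).
    { apply (hconv_re_const (fun n => b (phi n)) l l 0 Hl). intro n.
      destruct (Hq (phi n)) as [_ [Hb _]]. apply proj_compE in Hb.
      apply hinner_eq0, (proj1 Hb), Tl. }
    assert (E1 : hnorm l = 1).
    { apply (UL_sequence (fun n => hnorm (b (phi n)))).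
      - apply (hconv_norm (fun n => b (phi n))), Hl.
      - intros eps He. exists O. intros n _. destruct (Hq (phi n)) as [_ [_ [E _]]].
        fold (b (phi n)) in E. rewrite E. unfold Rdist.
        rewrite Rminus_diag, Rabs_R0. exact He. }
    rewrite <- hnorm_sq, E1 in E0. lra.
Qed.

(** * Self-adjointness of the sum *)

Lemma rel_sum_shift_surjective (c m : R) :
  is_subspace (rel_sum T A) -> conv_closed (rel_sum T A) -> is_hermitian (rel_sum T A) ->
  0 <= c ->
  (forall x s b, T_s T x s -> proj_comp T A x b ->
    hnorm b <= / 2 * hnorm s + c * hnorm x) ->
  Rabs m = 4 * c + 1 ->
  forall y, exists x, shift (rel_sum T A) (0, m) x y.
Proof.
  intros HSA HCA HhA Hc Hbound Hm.
  assert (Hm0 : m <> 0) by (intros ->; rewrite Rabs_R0 in Hm; lra).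
  apply bounded_below_surjective.
  - apply shift_subspace, HSA.
  - apply shift_conv_closed, HCA.
  - apply hermitian_nonreal_bounded_below; assumption.
  (* A vector [y] orthogonal to the range is written as [(T - i m) x]. Since [(S + A - i m) x]
     contains [y + b], the vector [y] is orthogonal to [y + b], which forces [y = 0] once
     [|b| < |y|] for nonzero [y]. *)
  - intros y Hy.
    destruct (selfadjoint_nonreal_resolvent T (0, m) HS HT Hm0) as [Hsurj _].
    destruct (Hsurj (hopp y)) as [x [f [Hx E]]].
    assert (Ey : y = f [-] (0, m) [*] x).
    { replace y with (hopp (hopp y)) by vec. rewrite E. vec. }
    destruct (parts_exist x f Hx) as [s [b [Hs Hb]]].
    assert (Horth : hinner y (y [+] b) = C0).
    { apply (Hy x). unfold shift.
      replace (y [+] b [+] (0, m) [*] x) with (f [+] b) by (rewrite Ey; vec).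
      apply rel_sum_proj_comp; assumption. }
    apply hinner_eq0 in Horth. destruct Horth as [Horth _]. rewrite re_add_r in Horth.
    assert (Him : im f x = 0).
    { assert (F := proj1 (HT _ _) Hx _ _ Hx). apply hinner_eqP in F. destruct F as [_ F].
      rewrite (im_sym f x) in F. lra. }
    assert (Hyy : re y y = re f f + m * m * re x x).
    { rewrite Ey. ip_expand. rewrite (re_sym f x), (im_sym f x), Him. ring. }
    assert (Hsf : hnorm s <= hnorm f).
    { apply T_s_iff in Hs. destruct Hs as [Hs1 Hs2]. apply (perp0_norm_le T); [exact Hs2|].
      replace (hzero : X) with (x [-] x) by vec. apply subspace_sub; assumption. }
    assert (Hfy : hnorm f <= hnorm y).
    { apply sq_le_reg; [apply hnorm_ge0|]. rewrite !hnorm_sq, Hyy.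
      generalize (re_diag_ge0 x). nra. }
    assert (Hxy : Rabs m * hnorm x <= hnorm y).
    { apply sq_le_reg; [apply hnorm_ge0|]. rewrite hnorm_sq, Hyy.
      replace (Rabs m * hnorm x * (Rabs m * hnorm x))
        with (Rabs m * Rabs m * (hnorm x * hnorm x)) by ring.
      rewrite hnorm_sq. replace (Rabs m * Rabs m) with (m * m) by exact (Rsqr_abs m).
      generalize (re_diag_ge0 f). lra. }
    assert (Hby := Hbound x s b Hs Hb). rewrite Hm in Hxy.
    assert (Px := hnorm_ge0 x). assert (Py := hnorm_ge0 y).
    (* Here [|s| <= |f| <= |y|] contributes 1/2, and [(4 c + 1) |x| <= |y|] makes [c |x|] at most a
       quarter of [|y|]. *)
    assert (Hb34 : hnorm b <= 3 / 4 * hnorm y) by lra.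
    assert (Hcs := cauchy_schwarz y (hopp b)). rewrite re_opp_r, hnorm_opp in Hcs.
    apply hnorm_eq0. rewrite <- hnorm_sq in Horth. nra.
Qed.

Lemma rel_sum_selfadjoint :
  is_subspace (rel_sum T A) -> is_closed (rel_sum T A) -> is_hermitian (rel_sum T A) ->
  is_selfadjoint (rel_sum T A).
Proof.
  intros HSA HCA HhA. apply is_closed_conv in HCA.
  destruct proj_comp_relative_bound as [c [Hc Hbound]].
  apply (selfadjoint_of_surjective _ (0, 4 * c + 1)); auto; unfold Cconj; cbn [fst snd];
    apply (rel_sum_shift_surjective c); auto.
  - apply Rabs_pos_eq. lra.
  - rewrite Rabs_Ropp. apply Rabs_pos_eq. lra.
Qed.

(** * Transfer of properness *)

Lemma proper_rel_sum (lam : R) :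
  proper (shift T (lam, 0)) -> proper (shift (rel_sum T A) (lam, 0)).
Proof.
  intros Hprop x h M Hxh HM Hh.
  assert (Hparts : forall n, exists s b, T_s T (x n) s /\ proj_comp T A (x n) b).
  { intro n. destruct (Hxh n) as [f [g [Hf _]]]. apply (parts_exist _ f Hf). }
  apply choice_fun in Hparts. destruct Hparts as [s Hparts].
  apply choice_fun in Hparts. destruct Hparts as [b Hparts].
  (* The representative of the given image orthogonal to [T(0)]; it stays Cauchy, while [h] may also
     vary along [T(0)]. *)
  set (k := fun n => s n [+] b n [-] (lam, 0) [*] x n).
  assert (Vp := perp0_vsubspace T). assert (Vm := multivalued_vsubspace T HS).
  assert (Hk : forall n, perp0 T (k n) /\ T hzero (h n [-] k n)).
  { intro n. destruct (Hparts n) as [Hs Hb]. split.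
    - assert (Hx := Hs). apply T_s_iff in Hx. destruct Hx as [Hx Hsp].
      apply proj_compE in Hb. apply vsubspace_sub; [exact Vp| |].
      + apply Vp; [exact Hsp|apply Hb].
      + apply Vp. apply (hermitian_dom_perp0 T _ (s n)); auto using selfadjoint_hermitian.
    - replace (h n [-] k n) with (h n [+] (lam, 0) [*] x n [-] (s n [+] b n))
        by (unfold k; vec).
      apply (rel_sum_parts (x n)); auto. apply Hxh. }
  assert (Hkc : hcauchy k).
  { apply (hcauchy_dominated k h 1); [|exact Hh]. intros n m. rewrite Rmult_1_l.
    apply (perp0_norm_le T); [apply vsubspace_sub; auto; apply Hk|].
    replace (h n [-] h m [-] (k n [-] k m)) with ((h n [-] k n) [-] (h m [-] k m)) by vec.
    apply (vsubspace_sub _ _ _ Vm); apply Hk. }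
  destruct (hcauchy_bounded k Hkc) as [K HK].
  destruct proj_comp_relative_bound as [c [Hc Hbound]].
  destruct Hcomp as [_ Hcp].
  (* The estimate [|s| <= K + |s| / 2 + c M + |lam| M] is solved for [|s|], hence the factor 2. *)
  destruct (Hcp x s b (M + 2 * (K + c * M + Rabs lam * M))) as [phi [l [Hphi Hl]]].
  - apply Hparts.
  - apply Hparts.
  - intro n. destruct (Hparts n) as [Hs Hb]. assert (H1 := Hbound _ _ _ Hs Hb).
    assert (H2 : hnorm (s n) <= hnorm (k n) + (hnorm (b n) + Rabs lam * hnorm (x n))).
    { rewrite <- hnorm_rscal.
      replace (s n) with (k n [+] ((lam, 0) [*] x n [-] b n)) at 1 by (unfold k; vec).
      apply Rle_trans with (1 := hnorm_triangle _ _).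
      generalize (hnorm_triangle_sub ((lam, 0) [*] x n) (b n)). lra. }
    assert (H3 : c * hnorm (x n) <= c * M) by (apply Rmult_le_compat_l; auto).
    assert (H4 : Rabs lam * hnorm (x n) <= Rabs lam * M)
      by (apply Rmult_le_compat_l; [apply Rabs_pos|auto]).
    generalize (HM n) (HK n). lra.
  - assert (Hf : hcauchy (fun n => k (phi n) [-] b (phi n))).
    { apply hcauchy_sub; [apply (hcauchy_subseq k phi Hphi Hkc)|].
      apply (hconv_cauchy _ l), Hl. }
    destruct (Hprop (fun n => x (phi n)) (fun n => k (phi n) [-] b (phi n)) M)
      as [psi [Hpsi Hx]]; [| |exact Hf|].
    + intro n. unfold shift, k.
      replace (s (phi n) [+] b (phi n) [-] (lam, 0) [*] x (phi n) [-] b (phi n)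
               [+] (lam, 0) [*] x (phi n)) with (s (phi n)) by vec.
      apply Hparts.
    + intro n. apply HM.
    + exists (fun n => phi (psi n)). split; [apply increasing_comp; assumption|exact Hx].
Qed.

(** Here [s = k + lam x] is bounded directly, so compactness applies at once; adding the convergent
    [b] to [k] gives Cauchy images under [S + A - lam]. *)
Lemma proper_of_rel_sum (lam : R) :
  proper (shift (rel_sum T A) (lam, 0)) -> proper (shift T (lam, 0)).
Proof.
  intros Hprop x f M Hxf HM Hf.
  assert (Hparts := fun n => parts_exist _ _ (Hxf n)).
  apply choice_fun in Hparts. destruct Hparts as [s Hparts].
  apply choice_fun in Hparts. destruct Hparts as [b Hparts].
  set (k := fun n => s n [-] (lam, 0) [*] x n).
  assert (Vp := perp0_vsubspace T). assert (Vm := multivalued_vsubspace T HS).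
  assert (Hk : forall n, perp0 T (k n) /\ T hzero (f n [-] k n)).
  { intro n. destruct (Hparts n) as [Hs _]. apply T_s_iff in Hs. destruct Hs as [Hs Hsp].
    split.
    - apply vsubspace_sub; [exact Vp|exact Hsp|]. apply Vp.
      apply (hermitian_dom_perp0 T _ (s n)); auto using selfadjoint_hermitian.
    - replace (f n [-] k n) with (f n [+] (lam, 0) [*] x n [-] s n) by (unfold k; vec).
      replace (hzero : X) with (x n [-] x n) by vec.
      apply subspace_sub; [exact HS|apply Hxf|exact Hs]. }
  assert (Hkc : hcauchy k).
  { apply (hcauchy_dominated k f 1); [|exact Hf]. intros n m. rewrite Rmult_1_l.
    apply (perp0_norm_le T); [apply vsubspace_sub; auto; apply Hk|].
    replace (f n [-] f m [-] (k n [-] k m)) with ((f n [-] k n) [-] (f m [-] k m)) by vec.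
    apply (vsubspace_sub _ _ _ Vm); apply Hk. }
  destruct (hcauchy_bounded k Hkc) as [K HK].
  destruct Hcomp as [_ Hcp].
  destruct (Hcp x s b (M + (K + Rabs lam * M))) as [phi [l [Hphi Hl]]].
  - apply Hparts.
  - apply Hparts.
  - intro n.
    assert (H2 : hnorm (s n) <= hnorm (k n) + Rabs lam * hnorm (x n)).
    { rewrite <- hnorm_rscal.
      replace (s n) with (k n [+] (lam, 0) [*] x n) at 1 by (unfold k; vec).
      apply hnorm_triangle. }
    assert (H4 : Rabs lam * hnorm (x n) <= Rabs lam * M)
      by (apply Rmult_le_compat_l; [apply Rabs_pos|auto]).
    generalize (HM n) (HK n). lra.
  - assert (Hg : hcauchy (fun n => k (phi n) [+] b (phi n))).
    { apply hcauchy_add; [apply (hcauchy_subseq k phi Hphi Hkc)|].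
      apply (hconv_cauchy _ l), Hl. }
    destruct (Hprop (fun n => x (phi n)) (fun n => k (phi n) [+] b (phi n)) M)
      as [psi [Hpsi Hx]]; [| |exact Hg|].
    + intro n. unfold shift, k.
      replace (s (phi n) [-] (lam, 0) [*] x (phi n) [+] b (phi n)
               [+] (lam, 0) [*] x (phi n)) with (s (phi n) [+] b (phi n)) by vec.
      apply rel_sum_proj_comp; apply Hparts.
    + intro n. apply HM.
    + exists (fun n => phi (psi n)). split; [apply increasing_comp; assumption|exact Hx].
Qed.

End Fixed.
End Perturbation.

Theorem theorem5p3 (X : CHilbert) (S A : @rel X) :
  is_subspace S -> is_selfadjoint S ->
  is_subspace A -> is_closed A -> is_hermitian A ->
  is_subspace (rel_sum S A) -> is_closed (rel_sum S A) -> is_hermitian (rel_sum S A) ->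
  (forall x, dom S x -> dom A x) ->
  rel_compact_wrt (proj_comp S A) (T_s S) ->
  (forall lam, ess_spectrum S lam <-> ess_spectrum (rel_sum S A) lam) /\
  ((forall lam, ~ ess_spectrum S lam) <-> (forall lam, ~ ess_spectrum (rel_sum S A) lam)).
Proof.
  intros HS HT HA _ HAh HSA HCA HhA Hdom Hcomp.
  assert (HTA : is_selfadjoint (rel_sum S A)) by (apply rel_sum_selfadjoint; assumption).
  assert (Hiff : forall lam, ess_spectrum S lam <-> ess_spectrum (rel_sum S A) lam).
  (* Both relations are self-adjoint, so their essential spectra are real and only real [lam] need
     comparison. *)
  { assert (Hreal : forall lam : R,
      ess_spectrum S (lam, 0) <-> ess_spectrum (rel_sum S A) (lam, 0)).
    { intro lam. rewrite !ess_spectrum_iff_not_proper by assumption.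
      split; intros Hn Hp; apply Hn.
      - apply (proper_of_rel_sum S A); assumption.
      - apply proper_rel_sum; assumption. }
    intros [l1 l2].
    split; intro H.
    - assert (E := selfadjoint_ess_spectrum_real _ _ HS HT H). simpl in E. subst l2.
      apply Hreal, H.
    - assert (E := selfadjoint_ess_spectrum_real _ _ HSA HTA H). simpl in E. subst l2.
      apply Hreal, H. }
  split; [exact Hiff|].
  split; intros H lam; [rewrite <- Hiff|rewrite Hiff]; apply H.
Qed.
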